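(* The separation problem of the inequalities $(\mathrm{LEPI'})$ $$w\ge\sum_{j=1}^n(\eta^\delta_{\delta_j}+b_{\delta_j})x_{\delta_j},\qquad \delta \text{ a permutation of } [n],$$ (or, of $\operatorname{conv}(X)$) can be solved in $O(n\log n)$ time. That is, there is an algorithm running in $O(n\log n)$ time which, given a point $(w^*,x^* )\in\mathbb{R}\times[0,1]^n$ with $\sum_{i\in N_k}x^*_i\le1$ for all $k\in[t]$, either finds an inequality $(\mathrm{LEPI'})$ that is violated by $(w^*,x^* )$, or determines that none exists, in which case $(w^*,x^* )\in\operatorname{conv}(X)$.
   Context: For a non-negative integer $m$, $[m]=\{1,\dots,m\}$ with $[0]=\varnothing$. Let $n,t$ be positive integers, $f:\mathbb{R}\to\mathbb{R}$ a concave function with $f(0)=0$, $a\in\mathbb{R}^n$ with non-negative entries, $b\in\mathbb{R}^n$, and $\{N_k\}_{k\in[t]}$ a partition of $[n]$ into consecutive blocks: with $i_0:=0$ and $i_k:=\sum_{j=1}^k|N_j|$, $N_k=\{i_{k-1}+1,\dots,i_k\}$. Within each block the entries of $a$ are ascending: $a_{i_{k-1}+1}\le\cdots\le a_{i_k}$ for all $k\in[t]$. For $S\subseteq[n]$, $a(S):=\sum_{i\in S}a_i$. Define $$X=\Big\{(w,x)\in\mathbb{R}\times\{0,1\}^n:\ w\ge f(a^\top x)+b^\top x,\ \sum_{i\in N_k}x_i\le1\ \forall k\in[t]\Big\}.$$ For a permutation $\delta=(\delta_1,\dots,\delta_n)$ of $[n]$, let $\delta(j):=\{\delta_1,\dots,\delta_j\}$.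 The lifting coefficients are defined recursively for $j=1,\dots,n$ by $$\eta^{\delta}_{\delta_j}:=\min_{S}\Big\{ f(a(S))-\sum_{i\in S\setminus\{\delta_j\}}\eta^{\delta}_i \;:\; S\subseteq\delta(j),\ |S\cap N_k|\le 1\ \ \forall k\in[t],\ \delta_j\in S\Big\}.$$ The separation problem of $\operatorname{conv}(X)$ is: given $(w^*,x^* )$ satisfying the trivial inequalities $0\le x_i\le1$ and $\sum_{i\in N_k}x_i\le1$, either find a valid inequality for $\operatorname{conv}(X)$ violated by $(w^*,x^* )$ or prove that none exists, i.e. $(w^*,x^* )\in\operatorname{conv}(X)$. Time is counted as the number of elementary operations (real arithmetic, comparisons, and evaluations of $f$ at a point, each at unit cost). *)

(* Defs.v *)
From HB Require Import structures.
From mathcomp Require Import all_boot all_order all_algebra all_fingroup.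
From mathcomp Require Import boolp classical_sets reals convex.

Set Implicit Arguments.
Unset Strict Implicit.
Unset Printing Implicit Defensive.

Import Order.TTheory GRing.Theory Num.Theory.

Local Open Scope ring_scope.

(** Indices are 0-based: [n] is ['I_n], [t] is ['I_t].  A partition of [n] into
    t consecutive blocks is given by its block sizes s : 'I_t -> nat. *)

Section Blocks.
Variables (n t : nat) (s : 'I_t -> nat).

Definition block_end (k : nat) : nat := (\sum_(j < t | j < k) s j)%N.

Definition block (k : 'I_t) : {set 'I_n} :=
  [set i : 'I_n | (block_end k <= i < block_end k.+1)%N].

Definition is_block_partition : Prop :=
  (forall k, 0 < s k)%N /\ (\sum_(k < t) s k)%N = n.

Definition at_most_one_per_block (S : {set 'I_n}) : bool :=
  [forall k : 'I_t, #|S :&: block k| <= 1]%N.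

Definition block_ascending (R : realType) (a : 'rV[R]_n) : Prop :=
  forall (k : 'I_t) (i j : 'I_n),
    i \in block k -> j \in block k -> (i <= j)%N -> a 0 i <= a 0 j.

End Blocks.

Definition concave (R : realType) (f : R -> R) : Prop :=
  convex_function [set: R^o] (fun x : R^o => - f x).

Section Lifting.
Variables (R : realType) (n t : nat) (s : 'I_t -> nat).
Variables (f : R -> R) (a b : 'rV[R]_n).

Definition asum (S : {set 'I_n}) : R := \sum_(i in S) a 0 i.

Section Permutation.
Variable delta : 'S_n.

Definition prefix (j : 'I_n) : {set 'I_n} :=
  [set delta l | l : 'I_n & (l <= j)%N].

Definition lift_feasible (j : 'I_n) (S : {set 'I_n}) : bool :=
  [&& S \subset prefix j, at_most_one_per_block s S & delta j \in S].

Definition lift_objective (eta : 'I_n -> R) (j : 'I_n) (S : {set 'I_n}) : R :=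
  f (asum S) - \sum_(i in S :\ delta j) eta i.

(* [set delta j] is always feasible, so [arg min] is a genuine minimizer. *)
Definition lift_min (eta : 'I_n -> R) (j : 'I_n) : R :=
  lift_objective eta j
    [arg min_(S < [set delta j] | lift_feasible j S) lift_objective eta j S]%O.

(* [enum 'I_n] is increasing: the entries at delta 0, delta 1, ... are filled in
   that order, each one from the previously computed entries. *)
Definition lift_coef : 'I_n -> R :=
  foldl (fun eta j i => if i == delta j then lift_min eta j else eta i)
        (fun=> 0) (enum 'I_n).

Definition lepi_rhs (x : 'rV[R]_n) : R :=
  \sum_(j < n) (lift_coef (delta j) + b 0 (delta j)) * x 0 (delta j).

End Permutation.

Definition X_set : set (R^o * 'rV[R]_n) :=
  [set p : R^o * 'rV[R]_n |
    [/\ forall i, p.2 0 i = 0 \/ p.2 0 i = 1,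
        f (\sum_i a 0 i * p.2 0 i) + \sum_i b 0 i * p.2 0 i <= p.1 &
        forall k : 'I_t, \sum_(i in block n s k) p.2 0 i <= 1]]%classic.

Definition conv_hull (M : lmodType R) (A : set M) : set M :=
  smallest (@convex_set R M) A.

End Lifting.

Lemma lift_coefP (R : realType) (n t : nat) (s : 'I_t -> nat) (f : R -> R)
    (a : 'rV[R]_n) (delta : 'S_n) (j : 'I_n) :
  let eta := lift_coef s f a delta in
  (exists2 S, lift_feasible s delta j S &
              eta (delta j) = lift_objective f a delta eta j S) /\
  (forall S, lift_feasible s delta j S ->
             eta (delta j) <= lift_objective f a delta eta j S).
Proof.
move=> F; rewrite {}/F; set d := delta.
set F := lift_coef s f a d.
have feas0 : lift_feasible s d j [set d j].
  apply/and3P; split; rewrite ?inE //.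
    by apply/fintype.subsetP => i /set1P ->; apply/imsetP; exists j; rewrite ?inE.
  apply/forallP => k; apply: leq_trans (subset_leq_card (subsetIl _ _)) _.
  by rewrite cards1.
pose stp (eta : 'I_n -> R) k i := if i == d k then lift_min s f a d eta k else eta i.
pose P m := foldl stp (fun=> 0) (take m (enum 'I_n)).
have PS (m : 'I_n) : P m.+1 = stp (P m) m.
  rewrite /P (take_nth m) ?size_enum_ord // -cats1 foldl_cat /=.
  by rewrite nth_ord_enum.
have later m k : (m <= n)%N -> (k < m)%N -> forall l : 'I_n, l = k :> nat -> P m (d l) = P k.+1 (d l).
  elim: m => // m IH mn; rewrite ltnS leq_eqVlt => /orP[/eqP -> //|km] l lk.
  rewrite (PS (Ordinal mn)) /stp /= (inj_eq perm_inj).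
  case: eqP => [E|_]; first by move: km; rewrite -lk E /= ltnn.
  exact: IH (ltnW mn) km l lk.
have FP : F = P n by rewrite /F /P -[X in take X]size_enum_ord take_size.
have Fl (l : 'I_n) : F (d l) = P l.+1 (d l) by rewrite FP (later n l).
have agree S : lift_feasible s d j S -> lift_objective f a d (P j) j S = lift_objective f a d F j S.
  case/and3P => /fintype.subsetP Sp _ _; rewrite /lift_objective; congr (_ - _).
  apply: eq_bigr => i; rewrite !inE => /andP[ij /Sp /imsetP[l]]; rewrite inE => lj Ei.
  rewrite Ei Fl (later j l) ?(ltnW (ltn_ord j)) //.
  by rewrite ltn_neqAle lj andbT; apply: contraNN ij => /eqP/val_inj <-; rewrite Ei.
have Fj : F (d j) = lift_min s f a d (P j) j by rewrite Fl PS /stp eqxx.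
move: Fj; rewrite /lift_min; case: arg_minP => // S Sf Smin Fj; split.
  by exists S => //; rewrite Fj agree.
by move=> S' S'f; rewrite Fj -agree //; exact: Smin.
Qed.

(** A real RAM: a fixed finite program acting on finitely many arrays of naturals
    and of reals, with a function f on the reals available as an oracle.  Reals
    are only accessible through field operations, comparisons and f; in
    particular there is no conversion from reals to naturals. *)

Inductive nexp :=
| NCst of nat
| NGet of nat & nexp
| NAdd of nexp & nexp
| NSub of nexp & nexp.

Inductive rexp :=
| RCst of int
| RGet of nat & nexp
| RAdd of rexp & rexp
| RSub of rexp & rexp
| RMul of rexp & rexp
| RDiv of rexp & rexp
| RFun of rexp.

Inductive bexp :=
| BLeN of nexp & nexp
| BLeR of rexp & rexp
| BNot of bexp
| BAnd of bexp & bexp.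

Inductive cmd :=
| Skip
| NSet of nat & nexp & nexp
| RSet of nat & nexp & rexp
| Seq of cmd & cmd
| If of bexp & cmd & cmd
| While of bexp & cmd.

(* Every node of an expression is charged one unit, so that index arithmetic and
   memory accesses are paid for as well as the operations on reals. *)
Fixpoint ncost (e : nexp) : nat :=
  match e with
  | NCst _ => 1
  | NGet _ i => (ncost i).+1
  | NAdd e1 e2 | NSub e1 e2 => (ncost e1 + ncost e2).+1
  end.

Fixpoint rcost (e : rexp) : nat :=
  match e with
  | RCst _ => 1
  | RGet _ i => (ncost i).+1
  | RAdd e1 e2 | RSub e1 e2 | RMul e1 e2 | RDiv e1 e2 =>
      (rcost e1 + rcost e2).+1
  | RFun e1 => (rcost e1).+1
  end.

Fixpoint bcost (e : bexp) : nat :=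
  match e with
  | BLeN e1 e2 => (ncost e1 + ncost e2).+1
  | BLeR e1 e2 => (rcost e1 + rcost e2).+1
  | BNot e1 => (bcost e1).+1
  | BAnd e1 e2 => (bcost e1 + bcost e2).+1
  end.

(* [nmem m r i] is the entry at index i of the array of naturals number r. *)
Record memory (R : Type) :=
  Memory { nmem : nat -> nat -> nat; rmem : nat -> nat -> R }.

Definition upd (T : Type) (M : nat -> nat -> T) (r i : nat) (v : T) :
    nat -> nat -> T :=
  fun r' i' => if (r' == r) && (i' == i) then v else M r' i'.

Section Semantics.
Variables (R : realType) (f : R -> R).
Implicit Types m : memory R.

Fixpoint neval m (e : nexp) : nat :=
  match e with
  | NCst c => c
  | NGet r i => nmem m r (neval m i)
  | NAdd e1 e2 => (neval m e1 + neval m e2)%N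
  | NSub e1 e2 => (neval m e1 - neval m e2)%N
  end.

Fixpoint reval m (e : rexp) : R :=
  match e with
  | RCst c => c%:~R
  | RGet r i => rmem m r (neval m i)
  | RAdd e1 e2 => reval m e1 + reval m e2
  | RSub e1 e2 => reval m e1 - reval m e2
  | RMul e1 e2 => reval m e1 * reval m e2
  | RDiv e1 e2 => reval m e1 / reval m e2
  | RFun e1 => f (reval m e1)
  end.

Fixpoint beval m (e : bexp) : bool :=
  match e with
  | BLeN e1 e2 => (neval m e1 <= neval m e2)%N
  | BLeR e1 e2 => reval m e1 <= reval m e2
  | BNot e1 => ~~ beval m e1
  | BAnd e1 e2 => beval m e1 && beval m e2
  end.

(* [exec c m m' T]: started in memory m, the program c halts in memory m' after
   T elementary operations. *)
Inductive exec : cmd -> memory R -> memory R -> nat -> Prop :=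
| ExecSkip m : exec Skip m m 1
| ExecNSet m r i e :
    exec (NSet r i e) m
      (Memory (upd (nmem m) r (neval m i) (neval m e)) (rmem m))
      (ncost i + ncost e).+1
| ExecRSet m r i e :
    exec (RSet r i e) m
      (Memory (nmem m) (upd (rmem m) r (neval m i) (reval m e)))
      (ncost i + rcost e).+1
| ExecSeq c1 c2 m1 m2 m3 T1 T2 :
    exec c1 m1 m2 T1 -> exec c2 m2 m3 T2 -> exec (Seq c1 c2) m1 m3 (T1 + T2)
| ExecIf e c1 c2 m m' T :
    exec (if beval m e then c1 else c2) m m' T ->
    exec (If e c1 c2) m m' (bcost e + T).+1
| ExecWhileF e c m :
    ~~ beval m e -> exec (While e c) m m (bcost e).+1
| ExecWhileT e c m m' m'' T T' :
    beval m e -> exec c m m' T -> exec (While e c) m' m'' T' ->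
    exec (While e c) m m'' (bcost e + T + T').+1.

End Semantics.

Lemma exec_deterministic (R : realType) (f : R -> R) c m m1 T1 :
  exec f c m m1 T1 -> forall m2 T2, exec f c m m2 T2 -> m1 = m2 /\ T1 = T2.
Proof.
elim=> {c m m1 T1}.
- by move=> m m2 T2 H; inversion H.
- by move=> m r i e m2 T2 H; inversion H.
- by move=> m r i e m2 T2 H; inversion H.
- move=> c1 c2 m m' m'' T T' _ I1 _ I2 m2 T2 H; inversion H as [| | |? ? ? ? ? ? ? H1 H2| | |]; subst.
  by case: (I1 _ _ H1) => ? ?; subst; case: (I2 _ _ H2) => -> ->.
- move=> e c1 c2 m m' T _ I m2 T2 H; inversion H as [| | | |? ? ? ? ? ? H1| |]; subst.
  by case: (I _ _ H1) => -> ->.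
- move=> e c m N m2 T2 H; inversion H as [| | | | | |? ? ? ? ? ? ? H1]; subst => //.
  by rewrite H1 in N.
- move=> e c m m' m'' T T' B _ I1 _ I2 m2 T2 H; inversion H as [| | | | |? ? ? N|? ? ? ? ? ? ? ? H1 H2]; subst.
    by rewrite B in N.
  by case: (I1 _ _ H1) => ? ?; subst; case: (I2 _ _ H2) => -> ->.
Qed.

Section SeparationIO.
Variables (R : realType) (n t : nat) (s : 'I_t -> nat).
Variables (f : R -> R) (a b : 'rV[R]_n) (w : R) (x : 'rV[R]_n).

Definition load (T : Type) (x0 : T) (arrays : seq (seq T)) : nat -> nat -> T :=
  fun r i => nth x0 (nth [::] arrays r) i.

Definition entries (v : 'rV[R]_n) : seq R := [seq v 0 i | i : 'I_n].

Definition input_memory : memory R :=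
  Memory (load 0%N [:: [:: n; t]; [seq s k | k : 'I_t]])
         (load 0 [:: entries a; entries b; entries x; [:: w]]).

(* Answer in nmem 2 0: 1 for a violated inequality, whose permutation is then in
   nmem 3 and whose coefficients are in rmem 4; 0 if there is none. *)
Definition correct_output (m : memory R) : Prop :=
  (nmem m 2 0 = 1%N /\
   exists delta : 'S_n,
     [/\ forall j : 'I_n, nmem m 3 j = delta j,
         forall i : 'I_n, rmem m 4 i = lift_coef s f a delta i + b 0 i,
         w < lepi_rhs s f a b delta x &
         forall p, conv_hull (X_set s f a b) p ->
           lepi_rhs s f a b delta p.2 <= p.1])
  \/
  (nmem m 2 0 = 0%N /\
   (forall delta : 'S_n, lepi_rhs s f a b delta x <= w) /\
   conv_hull (X_set s f a b) (w, x)).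

End SeparationIO.

(* Main.v *)
(** Within a block put y_l = the sum of the x_i with i >= l, and let d_l be the increments
    of the (ascending) entries of a.  Then a(S) = d(D) where D is the downward closure of S
    inside the blocks, so the problem becomes the separation of the extended polymatroid
    of D |-> f(d(D)), which is solved by Edmonds' greedy algorithm: sort the indices by
    decreasing y (ties by index) and let g be the successive increments of f along that
    order delta.  The lifting coefficients of delta are the prefix sums of g inside the
    blocks, and x is the convex combination, with weights the gaps of the sorted y, of the
    indicators of the maximal elements of the initial segments of delta.  Everything but
    the sorting is linear time; the sorting is a bottom-up merge sort. *)

Require Import Defs.
From mathcomp Require Import classical_sets reals convex.
From mathcomp Require Import all_boot all_order all_algebra all_fingroup.
From mathcomp Require Import interval_inference.
From mathcomp Require Import ring lra zify.

Set Implicit Arguments.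
Unset Strict Implicit.
Unset Printing Implicit Defensive.

Import Order.TTheory GRing.Theory Num.Theory.
Local Open Scope ring_scope.

(** * Concave functions and convex hulls *)

(** The lifting coefficients are minima over exponentially many sets, so the program never evaluates
    their definition; correctness rests on a sandwich. For every permutation, the minimum defining
    the coefficient of the last element of a feasible [S] already bounds the coefficient sum over
    [S] by [f (asum a S)], which makes all the inequalities valid. For the sorted permutation the
    greedy values obey the same bounds, because [f] is concave and the increments are nonnegative,
    and they are tight on the maximal elements of each initial segment. Tightness is used twice: it
    forces the greedy values to be the lifting coefficients, and it makes the right-hand side at [x]
    the average of the values at the points of [X] whose combination is [x]. Hence one inequality
    decides the problem: if it holds, the point lies in the hull, and validity then excludes a
    violation by any other permutation. On the cost side upper bounds suffice, and every loop body
    other than a merge pass is loop-free, hence of constant cost. *)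

Lemma concave_increment (R : realType) (f : R -> R) (u v h : R) :
  concave f -> u <= v -> 0 <= h -> f (v + h) - f v <= f (u + h) - f u.
Proof.
move=> fconc uv h0.
have avg (k x y : R) : 0 <= k -> k <= 1 ->
    k * f x + (1 - k) * f y <= f (k * x + (1 - k) * y).
  move=> k0 k1; have : - f (k * x + (1 - k) * y) <= k * - f x + (1 - k) * - f y.
    exact: fconc (Itv01 k0 k1) x y (classical_sets.in_setT _) (classical_sets.in_setT _).
  by rewrite !mulrN; lra.
have [hL|L0] := leP (v + h - u) 0.
  by rewrite (_ : v = u) //; lra.
(* Both [v] and [u + h] are convex combinations of the outer points [u] and [v + h], with the
   weights [k] and [1 - k] exchanged; the two concavity inequalities add up to the claim. *)
set L := v + h - u in L0; set k := h / L.
have k0 : 0 <= k by rewrite divr_ge0 // ltW.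
have k1 : k <= 1 by rewrite ler_pdivrMr // mul1r /L; lra.
have kL : k * L = h by rewrite divfK // gt_eqF.
have := avg k u (v + h) k0 k1.
have -> : k * u + (1 - k) * (v + h) = v.
  by transitivity (v + h - k * L); [rewrite /L; ring | rewrite kL; ring].
have := avg k (v + h) u k0 k1.
have -> : k * (v + h) + (1 - k) * u = u + h.
  by transitivity (u + k * L); [rewrite /L; ring | rewrite kL; ring].
lra.
Qed.

Lemma conv_hull_min (R : realType) (M : lmodType R) (A B : set M) :
  (A `<=` B)%classic ->
  (forall p q (k : R), B p -> B q -> 0 <= k -> k <= 1 ->
     B (k *: p + (1 - k) *: q)) ->
  (conv_hull A `<=` B)%classic.
Proof.
move=> AB Bconv; apply: smallest_sub => // p q k /set_mem Bp /set_mem Bq.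
by apply/mem_set; apply: Bconv.
Qed.

Lemma conv_hull_combine (R : realType) (M : lmodType R) (A : set M) p q (k : R) :
  conv_hull A p -> conv_hull A q -> 0 <= k -> k <= 1 ->
  conv_hull A (k *: p + (1 - k) *: q).
Proof.
move=> Ap Aq k0 k1 B BAA; have [Bconv _] := BAA.
by have /set_mem := Bconv p q (Itv01 k0 k1) (mem_set (Ap B BAA)) (mem_set (Aq B BAA)).
Qed.

Lemma conv_hull_sum (R : realType) (M : lmodType R) (A : set M) (m : nat)
    (lam : nat -> R) (p : nat -> M) :
  (forall j, (j < m)%N -> 0 <= lam j) -> \sum_(0 <= j < m) lam j = 1 ->
  (forall j, (j < m)%N -> A (p j)) ->
  conv_hull A (\sum_(0 <= j < m) lam j *: p j).
Proof.
move=> lam0 lam1 pA.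
have hullp j : (j < m)%N -> conv_hull A (p j) by move=> /pA; exact: sub_gen_smallest.
(* Partial sums are normalised by their own weight, so the induction only speaks of positive partial
   weights. *)
suff H k : (k <= m)%N -> 0 < \sum_(0 <= j < k) lam j ->
    conv_hull A ((\sum_(0 <= j < k) lam j)^-1 *: \sum_(0 <= j < k) lam j *: p j).
  by have := H m (leqnn m); rewrite lam1 invr1 scale1r; apply; exact: ltr01.
elim: k => [|k IH] km; first by rewrite big_geq // ltxx.
rewrite !big_nat_recr //=; set c := \sum_(_ <= _ < k) _; set v := \sum_(_ <= _ < k) _.
have c0 : 0 <= c.
  by rewrite /c big_nat; apply: sumr_ge0 => j /andP[_ jk]; apply/lam0/(ltn_trans jk).
have lk := lam0 _ km; move=> cl0.
(* If the weight collected so far is zero, all earlier weights vanish and the combination is the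
   single point [p k]. *)
have [cE|cN0] := eqVneq c 0.
  have v0 : v = 0.
    rewrite /v big_nat big1 // => j jk; move/eqP: cE.
    rewrite /c big_nat psumr_eq0; last by move=> l /andP[_ lk']; apply/lam0/(ltn_trans lk').
    move/allP => /(_ j); rewrite mem_index_iota => /(_ jk); rewrite jk /= => /eqP ->.
    by rewrite scale0r.
  rewrite v0 cE !add0r scalerA mulVf ?scale1r; first exact: hullp.
  by rewrite cE add0r in cl0; rewrite gt_eqF.
have cp : 0 < c by rewrite lt_def cN0.
have S0 : c + lam k != 0 by rewrite gt_eqF.
have := conv_hull_combine (IH (ltnW km) cp) (hullp _ km)
  (k := c / (c + lam k)) (divr_ge0 c0 (ltW cl0)).
rewrite ler_pdivrMr // mul1r lerDl lk => /(_ isT).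
rewrite -/v -/c scalerA scalerDr scalerA; congr (conv_hull A (_ *: _ + _ *: _)).
  by rewrite mulrAC mulfV // mul1r.
by field.
Qed.

(** * The order inside the blocks *)

Section BlockOrder.
Variables (n t : nat) (s : 'I_t -> nat).
Hypothesis part : is_block_partition n s.
Implicit Types (i l : 'I_n) (k : 'I_t) (S P : {set 'I_n}).

(** The argument is a natural number so that the position [n] can be queried too. With nonempty
    blocks the answer there is false, which is why suffix sums need a zero stored at [n]. *)
Definition block_first (i : nat) : bool := [exists k : 'I_t, i == block_end s k].

Definition below l i : bool :=
  (l <= i)%N && [exists k : 'I_t, (l \in block n s k) && (i \in block n s k)].

Lemma block_endS k : block_end s k.+1 = (block_end s k + s k)%N.
Proof.
rewrite /block_end (bigD1 k) //= addnC; congr (_ + _)%N; apply: eq_bigl => j.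
by rewrite -val_eqE /=; lia.
Qed.

Lemma block_end_mono (k k' : nat) : (k <= k')%N -> (block_end s k <= block_end s k')%N.
Proof.
move=> kk; rewrite /block_end [leqRHS]big_mkcond [leqLHS]big_mkcond /=.
by apply: leq_sum => j _; case: ltnP => // jk; rewrite (leq_trans jk).
Qed.

Lemma block_end0 : block_end s 0 = 0%N.
Proof. by rewrite /block_end big_pred0. Qed.

Lemma block_end_last : block_end s t = n.
Proof. by case: part => _ <-; rewrite /block_end; apply: eq_bigl => j; rewrite ltn_ord. Qed.

Lemma block_uniq i k k' : i \in block n s k -> i \in block n s k' -> k = k'.
Proof.
wlog kk : k k' / (k <= k')%N.
  by move=> H; case/orP: (leq_total k k') => /H // H' ? ?; symmetry; apply: H'.
rewrite !inE => /andP[_ ik] /andP[ki _]; apply/val_inj/eqP; rewrite eqn_leq kk /=.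
by rewrite leqNgt; apply/negP => /block_end_mono => ?; lia.
Qed.

Lemma block_ex i : exists k, i \in block n s k.
Proof.
have [j [jt ij]] : exists j, (j <= t)%N /\ (i < block_end s j)%N.
  by exists t; rewrite block_end_last.
elim: j jt ij => [|j IH] jt; first by rewrite block_end0.
have [ij _|ji ij] := ltnP i (block_end s j); first by apply: IH => //; exact: ltnW.
by exists (Ordinal jt); rewrite inE /= ji.
Qed.

Lemma belowP k l i : i \in block n s k -> below l i = (l <= i)%N && (l \in block n s k).
Proof.
move=> ik; rewrite /below; congr (_ && _); apply/existsP/idP => [[k' /andP[lk' ik']]|lk].
  by rewrite (block_uniq ik ik').
by exists k; rewrite lk.
Qed.

Lemma below_leq l i : below l i -> (l <= i)%N.
Proof. by case/andP. Qed.

Lemma below_refl i : below i i.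
Proof. by have [k ik] := block_ex i; rewrite (belowP _ ik) leqnn. Qed.

Lemma below_trans l i i' : below l i -> below i i' -> below l i'.
Proof.
have [k ik] := block_ex i'; rewrite !(belowP _ ik) => li /andP[ii iK].
by move: li; rewrite (belowP _ iK) => /andP[li ->]; rewrite (leq_trans li ii).
Qed.

Lemma below_chainl i l l' : below l i -> below l' i -> (l <= l')%N -> below l l'.
Proof.
have [k ik] := block_ex i; rewrite !(belowP _ ik) => /andP[_ lk] /andP[_ lk'] ll.
by rewrite (belowP _ lk') ll.
Qed.

Lemma below_chainr i l l' : below i l -> below i l' -> (l <= l')%N -> below l l'.
Proof.
case/andP => _ /existsP[k /andP[ik lk]]; case/andP => _ /existsP[k' /andP[ik' lk']] ll.
by rewrite (belowP _ lk') ll (block_uniq ik' ik).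
Qed.

(** [below] is a disjoint union of chains, one per block, so the feasible sets are exactly its
    antichains. *)
Lemma at_most_one_per_blockP S :
  reflect {in S &, forall l i, below l i -> l = i} (at_most_one_per_block s S).
Proof.
apply: (iffP forallP) => [H l i lS iS|H k].
  case/andP => _ /existsP[k /andP[lk ik]].
  by have /card_le1_eqP := H k; apply; rewrite inE ?lS ?iS.
apply/card_le1_eqP => i l /setIP[iS ik] /setIP[lS lk].
case/orP: (leq_total l i) => li; first by apply: (H l i) => //; rewrite (belowP _ ik) li.
by symmetry; apply: (H i l) => //; rewrite (belowP _ lk) li.
Qed.

Lemma below_first i l : block_first i -> below l i = (l == i).
Proof.
case/existsP => k0 /eqP ik0; have [k ik] := block_ex i.
have k0k : i \in block n s k0.
  by rewrite inE block_endS ik0 leqnn -[X in (X < _)%N]addn0 ltn_add2l; case: part => ->.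
rewrite (belowP _ k0k) !inE -ik0 -val_eqE /=; apply/idP/eqP => [/and3P[? ? _]|->].
  by lia.
by move: k0k; rewrite inE -ik0 leqnn.
Qed.

Lemma below_succ (i i' : 'I_n) l : i' = i.+1 :> nat ->
  below l i' = (l == i') || ~~ block_first i' && below l i.
Proof.
move=> ii'; have [F|NF] /= := boolP (block_first i'); first by rewrite orbF below_first.
have [k ik'] := block_ex i'.
have ik : i \in block n s k.
  have NE : i.+1 != block_end s k.
    by apply: contraNN NF => E; apply/existsP; exists k; rewrite ii'.
  by move: ik'; rewrite !inE ii'; lia.
rewrite (belowP _ ik) (belowP _ ik') -val_eqE /= ii'; have [/= E|NE] := eqVneq (l : nat) i.+1.
  by rewrite E leqnn /=; have /val_inj -> : l = i' :> nat by lia.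
by congr (_ && _); lia.
Qed.

Lemma below_succ_up (i i' : 'I_n) l : i' = i.+1 :> nat ->
  below i l = (l == i) || ~~ block_first i' && below i' l.
Proof.
move=> ii'; apply/idP/idP => [il|/orP[/eqP ->|/andP[NF il]]]; last 2 first.
- exact: below_refl.
- by apply: below_trans il; rewrite (below_succ _ ii') NF below_refl orbT.
have := below_leq il; rewrite leq_eqVlt => /orP[/eqP/val_inj ->|il']; first by rewrite eqxx.
have lk : below i' l.
  have [k lk] := block_ex l; have := il; rewrite !(belowP _ lk) ii' il' !inE ii' /= .
  by move: lk; rewrite inE; lia.
rewrite lk andbT; apply/orP; right; apply/negP => F.
have : below i i' by apply: below_chainl il lk _; lia.
by rewrite below_first // -val_eqE /= ii'; lia.
Qed.

Lemma below_last i l : i.+1 = n -> below i l = (l == i).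
Proof.
move=> iN; apply/idP/eqP => [/below_leq il|->]; last exact: below_refl.
by apply/val_inj => /=; have := ltn_ord l; lia.
Qed.

Definition downset S : {set 'I_n} := [set l | [exists i in S, below l i]].

Definition tops P : {set 'I_n} :=
  [set i in P | [forall i' in P, below i i' ==> (i' == i)]].

(** The parts of the chains below distinct members of an antichain are disjoint, since members of
    one block would be comparable. *)
Lemma sum_downset (V : nmodType) S (h : 'I_n -> V) : at_most_one_per_block s S ->
  \sum_(i in S) \sum_(l | below l i) h l = \sum_(l in downset S) h l.
Proof.
move=> /at_most_one_per_blockP S1; rewrite (exchange_big_dep predT) //=.
rewrite [RHS]big_mkcond; apply: eq_bigr => l _; rewrite inE.
case: ifPn => [/exists_inP[i iS li]|/exists_inPn N].
  rewrite (big_pred1 i) // => i' /=; apply/andP/eqP => [[iS' li']|-> //].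
  case/orP: (leq_total i i') => ii; first by rewrite (S1 i i') //; exact: below_chainr li li' ii.
  by rewrite (S1 i' i) //; exact: below_chainr li' li ii.
by rewrite big1 // => i /andP[iS li]; have := N i iS; rewrite li.
Qed.

Lemma tops_at_most_one P : at_most_one_per_block s (tops P).
Proof.
apply/at_most_one_per_blockP => l i; rewrite !inE => /andP[_ /forall_inP H] /andP[iP _] li.
by have /implyP /(_ li) /eqP := H i iP.
Qed.

(** With [sum_downset], this is the correspondence between antichains and down-sets that turns sums
    over feasible sets into sums over down-sets. *)
Lemma downset_tops P : (forall l i, i \in P -> below l i -> l \in P) ->
  downset (tops P) = P.
Proof.
move=> Pdown; apply/setP => l; rewrite inE; apply/exists_inP/idP => [[i]|lP].
  by rewrite inE => /andP[iP _]; exact: Pdown.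
have l0 : (l \in P) && below l l by rewrite lP below_refl.
case: (@arg_maxnP _ l (fun i => (i \in P) && below l i) val l0) => i /andP[iP li] imax.
exists i => //; rewrite inE iP; apply/forall_inP => i' iP'; apply/implyP => ii'.
have := imax i'; rewrite iP' (below_trans li ii') => /(_ isT) /= H.
by apply/eqP/val_inj/eqP; rewrite eqn_leq H below_leq.
Qed.

(** Closed form of the prefix recursion run inside each block. The term [G i.-1] is harmless at
    [i = 0] because position 0 starts a block. *)
Lemma sum_below_succ (V : nmodType) (i : 'I_n) (h : 'I_n -> V) (G : nat -> V) :
  (forall i, G i = h i + (if block_first i then 0 else G i.-1)) ->
  (0 < t)%N ->
  G i = \sum_(l | below l i) h l.
Proof.
move=> GE t0; have first0 : block_first 0.
  by apply/existsP; exists (Ordinal t0); rewrite block_end0.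
case: i => m; elim: m => [|m IH] mn; rewrite GE /=.
  rewrite first0 addr0 (eq_bigl (pred1 (Ordinal mn))) ?big_pred1_eq // => l.
  exact: below_first.
have mn' : (m < n)%N by lia.
case: ifPn => F.
  rewrite addr0 (eq_bigl (pred1 (Ordinal mn))) ?big_pred1_eq // => l.
  exact: below_first.
rewrite (bigD1 (Ordinal mn)) ?below_refl //= (IH mn'); congr (_ + _).
apply: eq_bigl => l; rewrite (@below_succ (Ordinal mn') (Ordinal mn)) // F /=.
case: eqVneq => [->|_] /=; last by rewrite andbT.
by apply/negP => /below_leq /=; rewrite ltnn.
Qed.

Lemma sum_above_pred (V : zmodType) (i : 'I_n) (h : 'I_n -> V) (Y : nat -> V) :
  (forall i : 'I_n, Y i = h i + (if block_first i.+1 then 0 else Y i.+1)) ->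
  Y n = 0 ->
  Y i = \sum_(l | below i l) h l.
Proof.
move=> YE Yn; have [m] := ubnP (n - i); elim: m i => // m IH i im; rewrite YE.
have [iN|iN] := eqVneq i.+1 n.
  rewrite iN Yn if_same addr0 (eq_bigl (pred1 i)) ?big_pred1_eq // => l.
  exact: below_last.
have iN' : (i.+1 < n)%N by have := ltn_ord i; lia.
have E l := @below_succ_up i (Ordinal iN') l erefl.
case: ifPn => F.
  rewrite addr0 (eq_bigl (pred1 i)) ?big_pred1_eq // => l.
  by rewrite E /= F orbF.
rewrite (bigD1 i) ?below_refl //= (IH (Ordinal iN')) //=; last by lia.
congr (_ + _); apply: eq_bigl => l; rewrite E /= F /=.
case: eqVneq => [->|_] /=; last by rewrite andbT.
by apply/negP => /below_leq /=; rewrite ltnn.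
Qed.

(** The suffix-sum operator is unitriangular, hence injective: [x] is recovered from its suffix
    sums. *)
Lemma eq_sum_above (V : zmodType) (u v : 'I_n -> V) :
  (forall l, \sum_(i | below l i) u i = \sum_(i | below l i) v i) -> u =1 v.
Proof.
move=> uv i; have [iN|iN] := eqVneq i.+1 n.
  have := uv i; rewrite !(eq_bigl (pred1 i)) ?big_pred1_eq // => l; exact: below_last.
have iN' : (i.+1 < n)%N by have := ltn_ord i; lia.
have E l := @below_succ_up i (Ordinal iN') l erefl.
have D (h : 'I_n -> V) : \sum_(l | below i l) h l =
    h i + (if block_first i.+1 then 0 else \sum_(l | below (Ordinal iN') l) h l).
  rewrite (bigD1 i) ?below_refl //=; congr (_ + _); case: ifPn => F.
    by rewrite big1 // => l; rewrite E /= F orbF => /andP[/eqP ->]; rewrite eqxx.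
  apply: eq_bigl => l; rewrite E /= F /=.
  case: eqVneq => [->|_] /=; last by rewrite andbT.
  by apply/esym/negP => /below_leq /=; rewrite ltnn.
by have := uv i; rewrite !D uv => /addIr.
Qed.

End BlockOrder.

(** * Greedy lifting *)

Lemma natr_cardI (R : pzRingType) (T : finType) (A B : {set T}) :
  #|A :&: B|%:R = \sum_(i in B) (i \in A)%:R :> R.
Proof.
rewrite -sum1_card natr_sum setIC big_mkcond [RHS]big_mkcond.
by apply: eq_bigr => i _; rewrite inE; case: (i \in B); case: (i \in A).
Qed.

Section Greedy.
Variables (R : realType) (n t : nat) (s : 'I_t -> nat) (f : R -> R).
Hypotheses (part : is_block_partition n s) (f0 : f 0 = 0).

Local Notation below := (below (n := n) s).

Lemma lepi_rhsE (a b : 'rV[R]_n) (delta : 'S_n) (x : 'rV[R]_n) :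
  lepi_rhs s f a b delta x =
  \sum_i lift_coef s f a delta i * x 0 i + \sum_i b 0 i * x 0 i.
Proof.
rewrite /lepi_rhs -big_split /= [RHS](reindex_inj (@perm_inj _ delta)) /=.
by apply: eq_bigr => j _; rewrite mulrDl.
Qed.

(** * Validity of the inequality of an arbitrary permutation *)

Section Validity.
Variables (a b : 'rV[R]_n) (delta : 'S_n).

Lemma mem_prefix (j l : 'I_n) : (delta l \in Defs.prefix delta j) = (l <= j)%N.
Proof.
by apply/imsetP/idP => [[k]|lj]; [rewrite inE => kj /perm_inj -> | exists l; rewrite ?inE].
Qed.

(** Take the member of [S] that comes last in [delta]: then [S] competes in the minimum defining its
    coefficient, and that one comparison is the claim. *)
Lemma lift_coef_le (S : {set 'I_n}) : at_most_one_per_block s S ->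
  \sum_(i in S) lift_coef s f a delta i <= f (asum a S).
Proof.
move=> S1; have [->|/set0Pn[i0 i0S]] := eqVneq S set0.
  by rewrite /asum !big_set0 f0.
have j0S : delta (delta^-1%g i0) \in S by rewrite permKV.
case: (@arg_maxnP _ _ (fun j => delta j \in S) val j0S) => j jS jmax.
have [_ /(_ S)] := lift_coefP s f a delta j; rewrite /lift_feasible S1 jS.
have -> : S \subset Defs.prefix delta j.
  apply/fintype.subsetP => i iS; rewrite -[i](permKV delta) mem_prefix.
  by apply: jmax; rewrite permKV.
move=> /(_ isT); rewrite /lift_objective [X in _ -> X <= _](big_setD1 (delta j)) //=; lra.
Qed.

Lemma lepi_valid p :
  conv_hull (X_set s f a b) p -> lepi_rhs s f a b delta p.2 <= p.1.
Proof.
pose B : set (R^o * 'rV[R]_n) := fun p => lepi_rhs s f a b delta p.2 <= p.1.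
apply: (@conv_hull_min _ _ _ B _ _ p); rewrite /B => {p}.
  (* A point of [X] is the indicator of a feasible set, where [lift_coef_le] applies; the inequality
     then extends to the hull because it cuts out a half-space. *)
  move=> [w x] /= [x01 xw xb]; pose S := [set i | x 0 i != 0].
  have xS i : x 0 i = (i \in S)%:R.
    by rewrite inE; case: (x01 i) => ->; rewrite ?eqxx // oner_eq0.
  have S1 : at_most_one_per_block s S.
    apply/forallP => k; rewrite -(ler_nat R) natr_cardI.
    by under eq_bigr do rewrite -xS; exact: xb.
  have SE (h : 'I_n -> R) : \sum_i h i * x 0 i = \sum_(i in S) h i.
    rewrite [RHS]big_mkcond; apply: eq_bigr => i _.
    by rewrite xS; case: ifP; rewrite ?mulr1 ?mulr0.
  rewrite lepi_rhsE; apply: le_trans xw; rewrite lerD2r !SE.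
  exact: lift_coef_le.
move=> [w1 x1] [w2 x2] k /=; rewrite !lepi_rhsE => H1 H2 k0 k1.
have SE (h : 'I_n -> R) : \sum_i h i * (k *: x1 + (1 - k) *: x2) 0 i =
    k * \sum_i h i * x1 0 i + (1 - k) * \sum_i h i * x2 0 i.
  by rewrite !mulr_sumr -big_split /=; apply: eq_bigr => i _; rewrite !mxE; ring.
rewrite !SE [leLHS](_ : _ =
  k * (\sum_i lift_coef s f a delta i * x1 0 i + \sum_i b 0 i * x1 0 i) +
  (1 - k) * (\sum_i lift_coef s f a delta i * x2 0 i + \sum_i b 0 i * x2 0 i)).
  by apply: lerD; apply: ler_wpM2l => //; rewrite subr_ge0.
by ring.
Qed.

End Validity.

(** * Greedy values along a linear extension of the block order *)

Variables (a b : 'rV[R]_n) (delta : 'S_n) (d g eta : 'I_n -> R).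
Hypothesis (fconc : concave f).
Hypothesis delta_below : forall i j : 'I_n, (i < j)%N -> ~~ below (delta j) (delta i).

Definition initial (m : nat) : {set 'I_n} := [set l | (delta^-1%g l < m)%N].

Hypothesis d_ge0 : forall i, 0 <= d i.
Hypothesis aE : forall i, a 0 i = \sum_(l | below l i) d l.
Hypothesis gE : forall j : 'I_n, g (delta j) =
  f (\sum_(l in initial j.+1) d l) - f (\sum_(l in initial j) d l).
Hypothesis etaE : forall i, eta i = \sum_(l | below l i) g l.

Lemma initialS (j : 'I_n) : initial j.+1 = delta j |: initial j.
Proof.
apply/setP => l; rewrite !inE ltnS leq_eqVlt; congr (_ || _).
by apply/eqP/eqP => [/val_inj <-|->]; rewrite ?permKV ?permK.
Qed.

Lemma initial_prefix (j : 'I_n) : initial j.+1 = Defs.prefix delta j.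
Proof. by apply/setP => l; rewrite -[l](permKV delta) mem_prefix inE permK. Qed.

Lemma initial_notin (j : 'I_n) : delta j \notin initial j.
Proof. by rewrite inE permK ltnn. Qed.

Lemma initial_down m l i : i \in initial m -> below l i -> l \in initial m.
Proof.
rewrite !inE => im li; apply: leq_trans im; rewrite ltnS leqNgt; apply/negP.
by move=> /delta_below; rewrite !permKV li.
Qed.

Lemma initial0 : initial 0 = set0.
Proof. by apply/setP => l; rewrite !inE. Qed.

Lemma sum_greedy_initial m : (m <= n)%N ->
  \sum_(l in initial m) g l = f (\sum_(l in initial m) d l).
Proof.
elim: m => [|m IH] mn; first by rewrite initial0 !big_set0 f0.
pose j := Ordinal mn; have := gE j; rewrite (initialS j) /= => gj.
by rewrite !big_setU1 ?initial_notin //= gj big_setU1 ?initial_notin //= IH 1?ltnW // subrK.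
Qed.

(** Feasibility of the greedy vector for the extended polymatroid. Elements are added in the order
    [delta]: the part of [D] met so far has smaller [d]-weight than the whole initial segment, so by
    concavity the increment of [f] over [D] is at least the greedy one. *)
Lemma sum_greedy_le (D : {set 'I_n}) : \sum_(l in D) g l <= f (\sum_(l in D) d l).
Proof.
suff H m : (m <= n)%N ->
    \sum_(l in D :&: initial m) g l <= f (\sum_(l in D :&: initial m) d l).
  have DE : D = D :&: initial n by apply/setP => l; rewrite !inE ltn_ord andbT.
  by rewrite DE; exact: H.
elim: m => [|m IH] mn.
  by rewrite initial0 setI0 !big_set0 f0.
pose j := Ordinal mn; have := IH (ltnW mn).
have [jD|jD] := boolP (delta j \in D); last first.
  suff -> : D :&: initial m.+1 = D :&: initial m by [].
  rewrite (initialS j); apply/setP => l; rewrite !inE.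
  by case: eqVneq => // ->; rewrite (negPf jD).
have -> : D :&: initial m.+1 = delta j |: (D :&: initial m).
  rewrite (initialS j); apply/setP => l; rewrite !inE.
  by case: eqVneq => // ->; rewrite jD.
have jN : delta j \notin D :&: initial m.
  by rewrite inE (negPf (initial_notin j)) andbF.
rewrite !big_setU1 //= gE initialS big_setU1 ?initial_notin //=.
have := @concave_increment _ f (\sum_(l in D :&: initial m) d l)
  (\sum_(l in initial m) d l) (d (delta j)) fconc _ (d_ge0 _).
rewrite (addrC (d _)) [d _ + _]addrC => H1 H2.
have : \sum_(l in D :&: initial m) d l <= \sum_(l in initial m) d l.
  rewrite [leRHS](big_setID D) /= setIC lerDl.
  by apply: sumr_ge0.
by move=> /H1; move: H2; set A := f _; set B := f _; set A' := f _; lra.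
Qed.

Lemma asum_downset S : at_most_one_per_block s S ->
  asum a S = \sum_(l in downset s S) d l.
Proof. by move=> S1; rewrite -sum_downset //; apply: eq_bigr => i _; rewrite aE. Qed.

Lemma eta_downset S : at_most_one_per_block s S ->
  \sum_(i in S) eta i = \sum_(l in downset s S) g l.
Proof. by move=> S1; rewrite -sum_downset //; apply: eq_bigr => i _; rewrite etaE. Qed.

Lemma eta_tops m : (m <= n)%N ->
  \sum_(i in tops s (initial m)) eta i = f (asum a (tops s (initial m))).
Proof.
move=> mn; have T1 := tops_at_most_one s (initial m).
rewrite eta_downset // asum_downset // downset_tops ?sum_greedy_initial //.
by move=> l i; exact: initial_down.
Qed.

(** Once earlier coefficients are known, the objective at [S] is [eta (delta j)] plus the slack
    [f (asum a S) - \sum_(i in S) eta i]. The slack is nonnegative on every feasible [S], so it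
    remains to find a feasible [S] without slack. *)
Lemma lift_coef_greedy : lift_coef s f a delta =1 eta.
Proof.
suff H m (j : 'I_n) : (j < m)%N -> lift_coef s f a delta (delta j) = eta (delta j).
  by move=> i; rewrite -[i](permKV delta); exact: H (ltnSn _).
elim: m j => // m IH j jm.
have agree S : lift_feasible s delta j S ->
    lift_objective f a delta (lift_coef s f a delta) j S =
    f (asum a S) - \sum_(i in S) eta i + eta (delta j).
  case/and3P => /fintype.subsetP Sp _ jS.
  rewrite /lift_objective [in RHS](big_setD1 (delta j)) //=.
  rewrite opprD addrA addrAC subrK.
  congr (_ - _); apply: eq_bigr => i; rewrite !inE => /andP[ij /Sp].
  rewrite -[i](permKV delta) mem_prefix => ij'; apply: IH.
  have NE : delta^-1%g i != j by apply: contraNneq ij => <-; rewrite permKV.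
  by rewrite -val_eqE /= in NE; lia.
have [[S Sf Sm] min] := lift_coefP s f a delta j.
apply/eqP; rewrite eq_le; apply/andP; split.
  (* The set without slack. It contains [delta j], because no element placed earlier lies above it
     in its block. *)
  pose S' := tops s (initial j.+1).
  have S'f : lift_feasible s delta j S'.
    apply/and3P; split; last 2 first.
    - exact: tops_at_most_one s _.
    - rewrite inE initialS setU11 /=; apply/forall_inP => i; rewrite -initialS inE ltnS.
      rewrite leq_eqVlt => /orP[/eqP/val_inj E|/delta_below]; last first.
        by rewrite permKV => /negPf ->.
      by rewrite -E permKV eqxx implybT.
    by rewrite -initial_prefix; apply/fintype.subsetP => i; rewrite inE => /andP[].
  have := min _ S'f; rewrite agree // eta_tops ?ltn_ord //.
  by rewrite subrr add0r.
rewrite Sm agree // lerDr subr_ge0; case/and3P: Sf => _ S1 _.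
by rewrite eta_downset // asum_downset // sum_greedy_le.
Qed.

(** * Decomposition of the point as a convex combination *)

Variables (x : 'rV[R]_n) (y : 'I_n -> R).
Hypothesis yE : forall l, y l = \sum_(i | below l i) x 0 i.
Hypothesis y01 : forall l, 0 <= y l <= 1.
Hypothesis y_delta : forall i j : 'I_n, (i <= j)%N -> y (delta j) <= y (delta i).

Lemma conv_hull_greedy w :
  \sum_i (eta i + b 0 i) * x 0 i <= w -> conv_hull (X_set s f a b) (w, x).
Proof.
move=> xw; pose T m := tops s (initial m).
(* The sorted values of [y], padded with 1 in front and 0 behind: the [n + 1] gaps are then
   nonnegative and telescope to 1, the empty segment receiving the weight [1 - y (delta 0)] when [n]
   is positive. *)
pose z m := if m is m'.+1 then oapp (fun j => y (delta j)) 0 (insub m') else 1.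
pose lam m := z m - z m.+1.
have z0 m : 0 <= z m <= 1.
  case: m => [|m] /=; first by rewrite ler01 lexx.
  by case: insubP => [j _ _|_] /=; [exact: y01 | rewrite lexx ler01].
have lam0 m : 0 <= lam m.
  rewrite subr_ge0; case: m => [|m]; first by case/andP: (z0 1).
  rewrite /z; case: (insubP _ m.+1) => [j jn jE|_] /=; last by have /andP[] := z0 m.+1.
  case: insubP => [i _ iE|]; last by rewrite -leqNgt; lia.
  by apply: y_delta; rewrite iE jE.
have zn : z n.+1 = 0 by rewrite /= insubN // -leqNgt.
have sum_lam m : (m <= n.+1)%N -> \sum_(m <= k < n.+1) lam k = z m.
  move=> mn; rewrite (eq_bigr (fun k => - (z k.+1 - z k))) => [|k _]; last by rewrite opprB.
  by rewrite sumrN telescope_sumr // zn sub0r opprK.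
pose chi m : 'rV[R]_n := \row_i (i \in T m)%:R.
have T1 m : at_most_one_per_block s (T m) by exact: tops_at_most_one.
have chiE m (h : 'I_n -> R) : \sum_i h i * chi m 0 i = \sum_(i in T m) h i.
  rewrite [RHS]big_mkcond; apply: eq_bigr => i _.
  by rewrite mxE; case: ifP; rewrite ?mulr1 ?mulr0.
(* Compared through suffix sums: the one of [chi m] at [l] is the indicator of [l \in initial m], so
   the weights that count are the gaps after the position of [l], and they add up to [y l]. *)
have xE : x = \sum_(0 <= m < n.+1) lam m *: chi m.
  apply/rowP; apply: (eq_sum_above part) => l; rewrite -yE.
  under [RHS]eq_bigr do rewrite summxE.
  rewrite exchange_big /=.
  have chil m : \sum_(i | below l i) (lam m *: chi m) 0 i = lam m * (l \in initial m)%:R.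
    under eq_bigr do rewrite !mxE.
    rewrite -mulr_sumr; congr (_ * _).
    (* Applied to the indicator of [l], this counts the elements of [T m] above [l]. *)
    have := sum_downset (fun l' => (l' == l)%:R : R) (T1 m).
    rewrite downset_tops //; last by move=> ? ?; exact: initial_down.
    have -> : \sum_(l' in initial m) (l' == l)%:R = (l \in initial m)%:R :> R.
      rewrite big_mkcond (bigD1 l) //= eqxx big1 ?addr0; first by case: ifP.
      by move=> i /negPf ->; case: ifP.
    move=> <-; rewrite [LHS]big_mkcond [RHS]big_mkcond; apply: eq_bigr => i _.
    have [iT|iT] := boolP (i \in T m); last by case: ifP.
    rewrite big_mkcond (bigD1 l) //= eqxx big1 ?addr0; first by case: ifP.
    by move=> k /negPf ->; case: ifP.
  under eq_bigr do rewrite chil.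
  pose j := delta^-1%g l.
  rewrite (@big_cat_nat _ _ _ j.+1) //=; last by apply/ltnW; rewrite ltnS.
  rewrite big_nat big1 ?add0r => [|m /andP[_ mj]]; last first.
    by rewrite inE ltnNge -ltnS mj mulr0.
  rewrite big_nat (eq_bigr lam) => [|m /andP[mj _]]; last by rewrite inE mj mulr1.
  by rewrite -big_nat sum_lam ?ltnS 1?ltnW // /z valK /= permKV.
have X_sum (h : 'I_n -> R) :
    \sum_i h i * x 0 i = \sum_(0 <= m < n.+1) lam m * \sum_(i in T m) h i.
  transitivity (\sum_i \sum_(0 <= m < n.+1) lam m * (h i * chi m 0 i)).
    apply: eq_bigr => i _; rewrite {1}xE summxE mulr_sumr.
    by apply: eq_bigr => m _; rewrite mxE mulrCA.
  by rewrite exchange_big /=; apply: eq_bigr => m _; rewrite -chiE mulr_sumr.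
have X_eta : \sum_i eta i * x 0 i = \sum_(0 <= m < n.+1) lam m * f (asum a (T m)).
  rewrite X_sum; apply: eq_big_nat => m /andP[_ mn].
  by rewrite -eta_tops.
have X_b := X_sum (b 0).
(* Every vertex is lifted by the same nonnegative amount, so that the combination hits [w] exactly;
   [X] is closed upwards in its first coordinate. *)
pose slack := w - \sum_i (eta i + b 0 i) * x 0 i.
pose p m : R^o * 'rV[R]_n := (f (asum a (T m)) + \sum_(i in T m) b 0 i + slack, chi m).
have lam1 : \sum_(0 <= m < n.+1) lam m = 1 by rewrite sum_lam.
have -> : (w, x) = \sum_(0 <= m < n.+1) lam m *: p m.
  rewrite [RHS]surjective_pairing; congr (_, _); last first.
    by rewrite (raddf_sum (@snd R^o 'rV[R]_n)).
  rewrite (raddf_sum (@fst R^o 'rV[R]_n)) /=.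
  under eq_bigr do rewrite /= [_ *: _]mulrDr mulrDr.
  rewrite !big_split /= -X_eta -X_b -mulr_suml lam1 mul1r /slack -big_split /=.
  under [in RHS]eq_bigr do rewrite -mulrDl.
  by rewrite addrC subrK.
apply: conv_hull_sum => // m _; split => /=.
- by move=> i; rewrite mxE; case: (_ \in _); [right|left].
- rewrite !chiE lerDl subr_ge0; exact: xw.
- move=> k; have /forallP /(_ k) := T1 m; rewrite -(ler_nat R) natr_cardI.
  by under [X in _ -> X <= _]eq_bigr do rewrite mxE.
Qed.

End Greedy.

(** * Cost-annotated program logic *)

Section ProgramLogic.
Variables (R : realType) (f : R -> R).
Implicit Types (m : memory R) (c : cmd) (Q : memory R -> Prop) (K : nat).

Definition runs c m K Q : Prop := exists m' T, [/\ exec f c m m' T, (T <= K)%N & Q m'].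

Lemma runs_weaken c m K K' Q Q' : runs c m K Q -> (K <= K')%N ->
  (forall m', Q m' -> Q' m') -> runs c m K' Q'.
Proof.
move=> [m' [T [cm TK Qm]]] KK QQ; exists m', T; split=> //; last exact: QQ.
exact: leq_trans KK.
Qed.

Lemma runs_seq c1 c2 m K1 K2 Q1 Q2 : runs c1 m K1 Q1 ->
  (forall m', Q1 m' -> runs c2 m' K2 Q2) -> runs (Seq c1 c2) m (K1 + K2) Q2.
Proof.
move=> [m1 [T1 [c1m TK1 Qm1]]] /(_ _ Qm1)[m2 [T2 [c2m TK2 Qm2]]].
exists m2, (T1 + T2)%N; split=> //; last exact: leq_add.
exact: ExecSeq c1m c2m.
Qed.

Fixpoint loop_free c : bool :=
  match c with
  | Skip | NSet _ _ _ | RSet _ _ _ => true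
  | Seq c1 c2 | If _ c1 c2 => loop_free c1 && loop_free c2
  | While _ _ => false
  end.

(** Lets loop-free code be verified by computation; the value at [While] is a placeholder. *)
Fixpoint run c m : memory R :=
  match c with
  | Skip | While _ _ => m
  | NSet r i e => Memory (upd (nmem m) r (neval m i) (neval m e)) (rmem m)
  | RSet r i e => Memory (nmem m) (upd (rmem m) r (neval m i) (reval f m e))
  | Seq c1 c2 => run c2 (run c1 m)
  | If e c1 c2 => if beval f m e then run c1 m else run c2 m
  end.

(** A conditional is charged for both branches, which keeps the bound independent of the memory. *)
Fixpoint max_cost c : nat :=
  match c with
  | Skip | While _ _ => 1
  | NSet _ i e => (ncost i + ncost e).+1
  | RSet _ i e => (ncost i + rcost e).+1
  | Seq c1 c2 => (max_cost c1 + max_cost c2)%N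
  | If e c1 c2 => (bcost e + (max_cost c1 + max_cost c2)).+1
  end.

Lemma runs_loop_free c m Q : loop_free c -> Q (run c m) -> runs c m (max_cost c) Q.
Proof.
move=> cl Qm; suff [T cT TK] : exists2 T, exec f c m (run c m) T & (T <= max_cost c)%N.
  by exists (run c m), T.
elim: c m cl {Qm} => //=.
- by move=> m _; exists 1%N => //; exact: ExecSkip.
- by move=> r i e m _; eexists; [exact: ExecNSet|].
- by move=> r i e m _; eexists; [exact: ExecRSet|].
- move=> c1 I1 c2 I2 m /andP[/(I1 m)[T1 E1 TK1] /(I2 (run c1 m))[T2 E2 TK2]].
  by exists (T1 + T2)%N; [exact: ExecSeq E1 E2 | exact: leq_add].
- move=> e c1 I1 c2 I2 m /andP[/(I1 m)[T1 E1 TK1] /(I2 m)[T2 E2 TK2]].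
  exists (bcost e + if beval f m e then T1 else T2).+1; first by apply: ExecIf; case: ifP.
  by rewrite ltnS leq_add2l; case: ifP => _; lia.
Qed.

Lemma runs_while e c m (N K : nat) (I : nat -> memory R -> Prop) :
  (forall k m, I k m -> (k <= N)%N -> beval f m e = (k < N)%N) ->
  (forall k m, I k m -> (k < N)%N -> runs c m K (I k.+1)) ->
  I 0%N m -> runs (While e c) m ((N.+1) * (bcost e + K).+1) (I N).
Proof.
move=> Ie Ic I0.
suff H k k' m' : (k + k' = N)%N -> I k m' -> runs (While e c) m' (k'.+1 * (bcost e + K).+1) (I N).
  exact: (H 0%N).
elim: k' k m' => [|k' IH] k m' kN Ik; rewrite mulSn.
  exists m', (bcost e).+1; split; last by rewrite -kN addn0.
    by apply: ExecWhileF; rewrite (Ie _ _ Ik) -kN addn0 ?ltnn.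
  lia.
have kN' : (k < N)%N by lia.
have [m1 [T1 [c1 TK1 I1]]] := Ic _ _ Ik kN'.
have [|m2 [T2 [c2 TK2 I2]]] := IH k.+1 m1 _ I1; first by lia.
exists m2, (bcost e + T1 + T2).+1; split=> //; last by lia.
by apply: ExecWhileT c1 c2; rewrite (Ie _ _ Ik (ltnW kN')).
Qed.

End ProgramLogic.

(** * Bottom-up merging *)

Section Merging.
Variables (le : rel nat) (n : nat).
Implicit Types (A B : nat -> nat) (w : nat).

Definition slice (A : nat -> nat) (lo hi : nat) : seq nat := [seq A k | k <- index_iota lo hi].

(** Comparisons across a multiple of [w] are exempt: width 1 demands nothing, and a width of at
    least [m] demands that the first [m] cells be sorted. *)
Definition run_sorted A w (m : nat) : Prop :=
  forall k, (k.+1 < m)%N -> ~~ (w %| k.+1)%N -> le (A k) (A k.+1).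

Lemma slice_recr A lo hi : (lo <= hi)%N -> slice A lo hi.+1 = rcons (slice A lo hi) (A hi).
Proof. by move=> lohi; rewrite /slice /index_iota subSn // -addn1 iotaD subnKC // map_cat cats1. Qed.

Lemma slice_cat A lo mid hi : (lo <= mid)%N -> (mid <= hi)%N ->
  slice A lo mid ++ slice A mid hi = slice A lo hi.
Proof.
move=> lm mh; rewrite /slice -map_cat /index_iota; congr map.
by rewrite -{2}(subnKC lm) -iotaD; congr iota; lia.
Qed.

Lemma eq_slice A B lo hi : (forall k, (lo <= k < hi)%N -> A k = B k) -> slice A lo hi = slice B lo hi.
Proof. by move=> AB; apply/eq_in_map => k; rewrite mem_index_iota; exact: AB. Qed.

Lemma between_multiples w lo k : (w %| lo)%N -> (lo < k)%N -> (k < lo + w)%N -> ~~ (w %| k)%N.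
Proof.
move=> wlo lok kw; rewrite -(subnKC (ltnW lok)) dvdn_addr // gtnNdvd //; lia.
Qed.

(* The first [p] cells of [B] hold the merged runs below [lo] and what has been merged so
   far of the adjacent runs [lo, mid) and [mid, hi) of [A], read up to [i] and [j]. *)
Record merging A B w p lo i mid j hi : Prop := Merging {
  merging_lo : (w.*2 %| lo)%N;
  merging_hi : hi = n \/ (w.*2 %| hi)%N;
  merging_mid : mid = (lo + w)%N \/ mid = hi;
  merging_pos : [&& lo <= i, i <= mid, mid <= j, j <= hi & hi <= n]%N;
  merging_len : [&& mid <= lo + w, hi <= lo + w.*2 & p + mid == i + j]%N;
  merging_perm : perm_eq (slice B 0 p) (slice A 0 i ++ slice A mid j);
  merging_sorted : run_sorted B w.*2 p;
  merging_last : (lo < p)%N ->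
    ((i < mid)%N -> le (B p.-1) (A i)) /\ ((j < hi)%N -> le (B p.-1) (A j))
}.

(** An empty pair of runs, already exhausted: the first iteration then reloads like any other,
    without a special case. *)
Lemma merging0 A B w : merging A B w 0 0 0 0 0 0.
Proof. by split=> //; right. Qed.

Lemma merging_reload A B w p lo i mid j hi :
  merging A B w p lo i mid j hi -> (hi <= p)%N -> (p < n)%N ->
  merging A B w p hi hi (minn (hi + w) n) (minn (hi + w) n) (minn (minn (hi + w) n + w) n).
Proof.
case=> dlo dhi _ /and5P[l1 l2 l3 l4 l5] /and3P[l6 l7 /eqP l8] perm srt last hip pn.
(* Forced by the balance [p + mid = i + j] together with [hi <= p]. *)
have [E1 E2 E3] : [/\ i = mid, j = hi & p = hi] by split; lia.
have dh : (w.*2 %| hi)%N by case: dhi => // E; lia.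
subst i j; split=> //.
- by have [|] := leqP (hi + w.*2) n; [right|left]; [rewrite (_ : minn _ _ = hi + w.*2)%N ?dvdn_add //; lia|lia].
- by lia.
- by lia.
- by lia.
- move: perm; rewrite slice_cat // => perm; rewrite /slice [X in _ ++ X]/= /index_iota subnn cats0.
  exact: perm.
- by rewrite E3 ltnn.
Qed.

Lemma run_sorted_rcons B w p v : run_sorted B w p ->
  (~~ (w %| p)%N -> (0 < p)%N -> le (B p.-1) v) ->
  run_sorted (fun k => if k == p then v else B k) w p.+1.
Proof.
move=> srt H k; rewrite ltnS leq_eqVlt => /orP[/eqP kp|kp] kd.
  by rewrite kp eqxx ifF -?kp; [move: H; rewrite -kp; apply|lia].
by rewrite !ifF; [exact: srt|lia|lia].
Qed.

Lemma slice_rcons B p v : slice (fun k => if k == p then v else B k) 0 p.+1 = rcons (slice B 0 p) v.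
Proof.
by rewrite slice_recr // eqxx; congr rcons; apply: eq_slice => k kp; rewrite ifF //; lia.
Qed.

Lemma merging_left A B w p lo i mid j hi :
  run_sorted A w n ->
  merging A B w p lo i mid j hi -> (i < mid)%N -> ((j < hi)%N -> le (A i) (A j)) ->
  merging A (fun k => if k == p then A i else B k) w p.+1 lo i.+1 mid j hi.
Proof.
move=> As [dlo dhi dmid /and5P[l1 l2 l3 l4 l5] /and3P[l6 l7 /eqP l8] perm srt last] im ij.
have lop : (lo <= p)%N by clear -l1 l2 l3 l8; lia.
have dlo' : (w %| lo)%N by apply: dvdn_trans dlo; rewrite -muln2 dvdn_mulr.
split=> //.
- by clear -l1 l2 l3 l4 l5 im; lia.
- by clear -l6 l7 l8; lia.
- rewrite slice_rcons slice_recr //; apply/seq.permP => q; have /seq.permP /(_ q) := perm.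
  by rewrite -!cats1 !count_cat => ->; rewrite addnAC.
(* At the start of a merged run no comparison is due; elsewhere [lo < p], and the last merged entry
   is known to precede both candidates. *)
- apply: run_sorted_rcons => // pd p0; have ltp : (lo < p)%N.
    by rewrite ltn_neqAle lop andbT; apply: contraNneq pd => <-.
  by have [H _] := last ltp; apply: H.
- move=> _ /=; rewrite eqxx; split=> // iM; apply: As; first by clear -iM l3 l4 l5; lia.
  by apply: between_multiples dlo' _ _; clear -iM l1 l6; lia.
Qed.

Lemma merging_right A B w p lo i mid j hi :
  run_sorted A w n ->
  merging A B w p lo i mid j hi -> (j < hi)%N -> ((i < mid)%N -> le (A j) (A i)) ->
  merging A (fun k => if k == p then A j else B k) w p.+1 lo i mid j.+1 hi.
Proof.
move=> As [dlo dhi dmid /and5P[l1 l2 l3 l4 l5] /and3P[l6 l7 /eqP l8] perm srt last] jh ij.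
have lop : (lo <= p)%N by clear -l1 l2 l3 l8; lia.
have dlo' : (w %| lo)%N by apply: dvdn_trans dlo; rewrite -muln2 dvdn_mulr.
split=> //.
- by clear -l1 l2 l3 l4 l5 jh; lia.
- by clear -l6 l7 l8; lia.
- rewrite slice_rcons [slice A mid _]slice_recr //; apply/seq.permP => q; have /seq.permP /(_ q) := perm.
  by rewrite -!cats1 !count_cat => ->; rewrite addnA.
- apply: run_sorted_rcons => // pd p0; have ltp : (lo < p)%N.
    by rewrite ltn_neqAle lop andbT; apply: contraNneq pd => <-.
  by have [_ H] := last ltp; apply: H.
- move=> _ /=; rewrite eqxx; split=> // jH; apply: As; first by clear -jH l5; lia.
  (* A nonempty right run means that the left run was not cut off by [n], so the right run starts at
     a multiple of [w]. *)
  have E : mid = (lo + w)%N by clear -dmid jH l3; lia.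
  have dm : (w %| mid)%N by rewrite E dvdn_add.
  by apply: between_multiples dm _ _; clear -E jH l3 l7; lia.
Qed.

Lemma merging_end A B w lo i mid j hi : merging A B w n lo i mid j hi ->
  perm_eq (slice B 0 n) (slice A 0 n) /\ run_sorted B w.*2 n.
Proof.
case=> _ _ _ /and5P[l1 l2 l3 l4 l5] /and3P[l6 l7 /eqP l8] perm srt _; split=> //.
have [Ei Ej] : i = mid /\ j = n by clear -l2 l3 l4 l5 l8; lia.
have midn : (mid <= n)%N by clear -l3 l4 l5; lia.
by move: perm; rewrite Ei Ej slice_cat.
Qed.

End Merging.

(** * The separation program *)

Local Notation nvar r := (NGet r (NCst 0)).
Local Notation rvar r := (RGet r (NCst 0)).
Local Notation nset r e := (NSet r (NCst 0) e).
Local Notation rset r e := (RSet r (NCst 0) e).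
Local Notation incr r := (nset r (NAdd (nvar r) (NCst 1))).
Local Notation ltn_exp e1 e2 := (BNot (BLeN e2 e1)).
Local Notation "c1 ;; c2" := (Seq c1 c2) (at level 70, right associativity).

(* Arrays of naturals and of reals are numbered independently; 0-1 resp. 0-3 hold the
   input, and ANS, PERM, OUT are the ones [correct_output] inspects. *)
Local Notation ANS := 2%N.
Local Notation PERM := 3%N.
Local Notation BUF := 4%N.
Local Notation FIRST := 5%N.
Local Notation CNT := 6%N.
Local Notation POS := 7%N.
Local Notation LEFT := 8%N.
Local Notation MID := 9%N.
Local Notation RIGHT := 10%N.
Local Notation HI := 11%N.
Local Notation WIDTH := 12%N.

Local Notation OUT := 4%N.
Local Notation SUF := 5%N.
Local Notation GREEDY := 6%N.
Local Notation ACC := 7%N.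
Local Notation TMP := 8%N.
Local Notation ETA := 9%N.
Local Notation size_exp := (NGet 0 (NCst 0)).
Local Notation blocks_exp := (NGet 0 (NCst 1)).

Definition counted e c := nset CNT (NCst 0) ;; While (ltn_exp (nvar CNT) e) (c ;; incr CNT).

(* 20 is a generous constant for the bookkeeping of the counter. *)
Definition counted_cost e c : nat := (bcost (ltn_exp (nvar CNT) e) + max_cost c + 20)%N.

(** The slack between [N] and [K] lets the loop over the [t] blocks be charged in terms of [n], like
    the others. *)
Lemma runs_counted (R : realType) (f : R -> R) e c (N K : nat) (I : nat -> memory R -> Prop) m :
  loop_free c -> (N <= K)%N ->
  I 0%N (run f (nset CNT (NCst 0)) m) ->
  (forall k m, I k m -> neval m e = N) ->
  (forall k m, I k m -> nmem m CNT 0 = k -> (k < N)%N ->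
     nmem (run f c m) CNT 0 = k /\ I k.+1 (run f (c ;; incr CNT) m)) ->
  runs f (counted e c) m (counted_cost e c * K.+1) (I N).
Proof.
move=> cl NK I0 IN IS; pose J k m := nmem m CNT 0 = k /\ I k m.
have H0 : runs f (nset CNT (NCst 0)) m 3 (J 0%N) by apply: runs_loop_free.
have H1 m1 : J 0%N m1 -> runs f (While (ltn_exp (nvar CNT) e) (c ;; incr CNT)) m1
    (N.+1 * (bcost (ltn_exp (nvar CNT) e) + max_cost (c ;; incr CNT)).+1) (J N).
  apply: runs_while => k m' [cm Ik] kN; first by rewrite /= cm (IN _ _ Ik) -ltnNge.
  apply: runs_loop_free; first by rewrite /= cl.
  by have [E Ik'] := IS _ _ Ik cm kN; split=> //=; rewrite /upd /= E addn1.
apply: runs_weaken (runs_seq H0 H1) _ _ => [|m' [] //].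
rewrite /counted_cost /=; set b := ncost e; set x := max_cost c.
by nia.
Qed.

(* Ties are broken by the index, so that inside a block smaller indices come first. *)
Definition precedes (R : realType) (y : nat -> R) : rel nat :=
  fun u v => (y v <= y u) && ~~ ((y u <= y v) && ~~ (u <= v)%N).

Lemma precedes_total (R : realType) (y : nat -> R) u v : ~~ precedes y u v -> precedes y v u.
Proof. by rewrite /precedes; case: (ltgtP (y u) (y v)) => //= _; case: ltngtP. Qed.

Lemma precedes_trans (R : realType) (y : nat -> R) : transitive (precedes y).
Proof.
rewrite /precedes => v u z; rewrite !negb_and !negbK.
move=> /andP[vu uv] /andP[zv vz]; rewrite (le_trans zv vu) /=.
case: leP => //= uz; have yuv : y u <= y v by apply: le_trans uz zv.
have yvz : y v <= y z by apply: le_trans vu uz.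
by rewrite yuv in uv; rewrite yvz in vz; exact: leq_trans uv vz.
Qed.

Definition first_test e := BLeN (NCst 1) (NGet FIRST e).

Definition mark_body :=
  NSet FIRST (nvar POS) (NCst 1) ;; nset POS (NAdd (nvar POS) (NGet 1 (nvar CNT))).

Definition suffix_body :=
  let i := NSub size_exp (NAdd (nvar CNT) (NCst 1)) in
  let i' := NSub size_exp (nvar CNT) in
  If (first_test i') (RSet SUF i (RGet 2 i)) (RSet SUF i (RAdd (RGet 2 i) (RGet SUF i'))).

(** With truncated subtraction this is the minimum. *)
Definition min_exp e1 e2 := NSub e1 (NSub e1 e2).

Definition reload :=
  nset LEFT (nvar HI) ;; nset MID (min_exp (NAdd (nvar HI) (nvar WIDTH)) size_exp) ;;
  nset RIGHT (nvar MID) ;; nset HI (min_exp (NAdd (nvar MID) (nvar WIDTH)) size_exp).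

Definition take_from r := NSet BUF (nvar CNT) (NGet PERM (nvar r)) ;; incr r.

(** Tests are built from negation and conjunction only; [precedes] has the same shape, so evaluating
    this test yields it by conversion. *)
Definition precedes_exp u v :=
  BAnd (BLeR (RGet SUF v) (RGet SUF u))
       (BNot (BAnd (BLeR (RGet SUF u) (RGet SUF v)) (BNot (BLeN u v)))).

Definition merge_one :=
  If (BLeN (nvar MID) (nvar LEFT)) (take_from RIGHT)
  (If (BLeN (nvar HI) (nvar RIGHT)) (take_from LEFT)
  (If (precedes_exp (NGet PERM (nvar LEFT)) (NGet PERM (nvar RIGHT)))
    (take_from LEFT) (take_from RIGHT))).

Definition merge_body := If (BLeN (nvar HI) (nvar CNT)) reload Skip ;; merge_one.

Definition copy_body := NSet PERM (nvar CNT) (NGet BUF (nvar CNT)).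

Definition merge_init :=
  nset LEFT (NCst 0) ;; nset MID (NCst 0) ;; nset RIGHT (NCst 0) ;; nset HI (NCst 0).

Definition merge_pass :=
  merge_init ;; counted size_exp merge_body ;; counted size_exp copy_body ;;
  nset WIDTH (NAdd (nvar WIDTH) (nvar WIDTH)).

Definition id_body := NSet PERM (nvar CNT) (nvar CNT).

Definition merge_sort := counted size_exp id_body ;; nset WIDTH (NCst 1) ;;
  While (ltn_exp (nvar WIDTH) size_exp) merge_pass.

Definition greedy_body :=
  let i := NGet PERM (nvar CNT) in
  If (first_test i) (rset TMP (RGet 0 i))
    (rset TMP (RSub (RGet 0 i) (RGet 0 (NSub i (NCst 1))))) ;;
  RSet GREEDY i (RSub (RFun (RAdd (rvar ACC) (rvar TMP))) (RFun (rvar ACC))) ;;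
  rset ACC (RAdd (rvar ACC) (rvar TMP)).

Definition lift_body :=
  let i := nvar CNT in
  If (first_test i) (RSet ETA i (RGet GREEDY i))
    (RSet ETA i (RAdd (RGet GREEDY i) (RGet ETA (NSub i (NCst 1))))) ;;
  RSet OUT i (RAdd (RGet ETA i) (RGet 1 i)) ;;
  rset ACC (RAdd (rvar ACC) (RMul (RGet OUT i) (RGet 2 i))).

Definition answer := If (BLeR (rvar ACC) (rvar 3)) (nset ANS (NCst 0)) (nset ANS (NCst 1)).

Definition separation :=
  counted blocks_exp mark_body ;;
  RSet SUF size_exp (RCst 0) ;;
  counted size_exp suffix_body ;;
  merge_sort ;;
  rset ACC (RCst 0) ;;
  counted size_exp greedy_body ;;
  rset ACC (RCst 0) ;;
  counted size_exp lift_body ;;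
  answer.

(** * Invariants and running times of the stages *)

Section Stages.
Variables (R : realType) (f : R -> R) (n t : nat) (s : 'I_t -> nat).
Variables (sN : nat -> nat) (aN bN xN : nat -> R) (w : R).
Hypothesis sNE : forall k : 'I_t, sN k = s k.
Hypothesis part : is_block_partition n s.
Implicit Types m : memory R.

Definition has_input m : Prop :=
  [/\ nmem m 0 0 = n, nmem m 0 1 = t & nmem m 1 =1 sN] /\
  [/\ rmem m 0 =1 aN, rmem m 1 =1 bN, rmem m 2 =1 xN & rmem m 3 0 = w].

Definition has_first m : Prop :=
  has_input m /\ forall i, nmem m FIRST i = block_first s i.

Definition suffix_sums (y : nat -> R) (lo : nat) : Prop :=
  y n = 0 /\ forall i, (lo <= i < n)%N ->
    y i = xN i + (if block_first s i.+1 then 0 else y i.+1).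

Lemma blocks_le : (t <= n)%N.
Proof.
case: part => s0 <-; rewrite -[X in (X <= _)%N](card_ord t) -sum1_card.
by apply: leq_sum => k _; exact: s0.
Qed.

Lemma mark_first m : has_input m ->
  (forall i, nmem m FIRST i = 0%N) -> nmem m POS 0 = 0%N ->
  runs f (counted blocks_exp mark_body) m (counted_cost blocks_exp mark_body * n.+1) has_first.
Proof.
move=> im F0 P0.
pose I k m := [/\ has_input m, nmem m POS 0 = block_end s k &
  forall i, nmem m FIRST i = [exists j : 'I_t, (j < k)%N && (i == block_end s j)]].
apply: runs_weaken (_ : runs _ _ _ (_ * _) (I t)) _ _ => //; last first.
  move=> m' [im' _ F]; split=> // i; rewrite F; congr nat_of_bool.
  by apply: eq_existsb => j; rewrite ltn_ord.
apply: runs_counted => //; first exact: blocks_le.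
- split=> //=; rewrite /upd /=; first by rewrite P0 block_end0.
  by move=> i; rewrite F0; apply/esym/eqP; rewrite eqb0; apply/existsPn.
- by move=> k m' [[[]]].
move=> k m' [im' P F] kE kt; split=> //; split; first exact: im'.
  rewrite /= /upd /= P kE; have [[_ _ ->] _] := im'.
  by rewrite (sNE (Ordinal kt)) -(block_endS s (Ordinal kt)).
move=> i; rewrite /= /upd /= P F; case: eqVneq => [->|ik].
  by apply/esym/eqP; rewrite eqb1; apply/existsP; exists (Ordinal kt); rewrite /= leqnn eqxx.
congr nat_of_bool; apply: eq_existsb => j; rewrite [in RHS]ltnS [in RHS]leq_eqVlt andb_orl.
by have [->|//] := eqVneq (j : nat) k; rewrite (negPf ik) andbF.
Qed.

Lemma suffix_loop m : has_first m -> rmem m SUF n = 0 ->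
  runs f (counted size_exp suffix_body) m (counted_cost size_exp suffix_body * n.+1)
    (fun m' => has_first m' /\ suffix_sums (rmem m' SUF) 0).
Proof.
move=> fm y0; pose I k m := has_first m /\ suffix_sums (rmem m SUF) (n - k).
apply: runs_weaken (_ : runs _ _ _ (_ * _) (I n)) _ _ => //; last first.
  by move=> m' []; rewrite subnn.
apply: runs_counted => //.
- split=> //; split=> //= i; rewrite subn0 => /andP[? ?]; lia.
- by move=> k m' [[[[]]]].
move=> k m' [fm' [yn yi]] kE kn; have [[[nE _ _] [_ _ xE _]] F] := fm'.
rewrite /= nE kE F addn1.
have jE : (n - k = (n - k.+1).+1)%N by lia.
have E (v : R) : v = xN (n - k.+1) + (if block_first s (n - k) then 0 else rmem m' SUF (n - k)) ->
    suffix_sums (upd (rmem m') SUF (n - k.+1) v SUF) (n - k.+1).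
  move=> vE; split=> [|i ilo]; rewrite /upd /=; first by rewrite ifF //; lia.
  have -> : (i.+1 == n - k.+1)%N = false by lia.
  case: eqVneq => [->|ik]; first by rewrite vE jE.
  by apply: yi; lia.
case: (block_first s (n - k)) E => /= E; split=> //; split=> //; apply: E; rewrite xE //.
by rewrite addr0.
Qed.

Definition has_suffix y m : Prop := has_first m /\ rmem m SUF = y.

(** * Merge sort by decreasing suffix sum *)

Section Sorting.
Variable y : nat -> R.
Hypothesis n0 : (0 < n)%N.

Definition is_order (A : nat -> nat) : Prop := perm_eq (slice A 0 n) (iota 0 n).

Lemma reload_step A B w0 k lo m : has_suffix y m -> nmem m WIDTH 0 = w0 ->
  nmem m CNT 0 = k -> (k < n)%N -> nmem m PERM = A -> nmem m BUF = B ->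
  merging (precedes y) n A B w0 k lo (nmem m LEFT 0) (nmem m MID 0) (nmem m RIGHT 0) (nmem m HI 0) ->
  (0 < w0)%N ->
  let m' := run f (If (BLeN (nvar HI) (nvar CNT)) reload Skip) m in
  [/\ has_suffix y m', nmem m' WIDTH 0 = w0, nmem m' CNT 0 = k, nmem m' PERM = A & nmem m' BUF = B] /\
  (k < nmem m' HI 0)%N /\ exists lo',
  merging (precedes y) n A B w0 k lo' (nmem m' LEFT 0) (nmem m' MID 0) (nmem m' RIGHT 0) (nmem m' HI 0).
Proof.
move=> sm wE kE kn AE BE mg w0p /=; rewrite kE; case: (leqP (nmem m HI 0) k) => hk /=; last by split=> [|]; [split | split=> //; exists lo].
split; first by [].
have minE (u v : nat) : (u - (u - v) = minn u v)%N by lia.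
have [[[[nE _ _] _] _] _] := sm.
rewrite /upd /= wE nE !minE; split; last by exists (nmem m HI 0); apply: merging_reload mg hk kn.
by have := merging_pos mg; have := merging_len mg; clear -w0p kn hk; lia.
Qed.

Lemma merge_loop A w0 m : has_suffix y m -> nmem m WIDTH 0 = w0 -> (0 < w0)%N ->
  nmem m PERM = A -> is_order A -> run_sorted (precedes y) A w0 n ->
  nmem m LEFT 0 = 0%N -> nmem m MID 0 = 0%N -> nmem m RIGHT 0 = 0%N -> nmem m HI 0 = 0%N ->
  runs f (counted size_exp merge_body) m (counted_cost size_exp merge_body * n.+1)
    (fun m' => [/\ has_suffix y m', nmem m' WIDTH 0 = w0, is_order (nmem m' BUF) &
       run_sorted (precedes y) (nmem m' BUF) w0.*2 n]).
Proof.
move=> sm wE w0p AE Ao As l0 mi0 r0 h0.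
pose I k m := [/\ has_suffix y m, nmem m WIDTH 0 = w0, nmem m PERM = A &
  exists lo, merging (precedes y) n A (nmem m BUF) w0 k lo
    (nmem m LEFT 0) (nmem m MID 0) (nmem m RIGHT 0) (nmem m HI 0)].
apply: runs_weaken (_ : runs _ _ _ (_ * _) (I n)) _ _ => //; last first.
  move=> m' [sm' wE' _ [lo /merging_end[Bp Bs]]]; split=> //.
  exact: seq.perm_trans Bp Ao.
apply: runs_counted => //.
- split=> //; exists 0%N; rewrite /= /upd /= l0 mi0 r0 h0; exact: merging0.
- by move=> k m' [[[[[]]]]].
move=> k m1 [sm1 wE1 AE1 [lo mg]] kE kn.
have /= := reload_step sm1 wE1 kE kn AE1 erefl mg w0p; rewrite /merge_body /=.
set m2 := if _ then _ else _; case=> [[sm2 wE2 kE2 AE2 _] [kh [lo' mg']]].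
have yE : rmem m2 SUF = y by case: sm2.
have BE : nmem m2 BUF = nmem m1 BUF by rewrite /m2; case: ifP.
rewrite -BE in mg'.
have [L Rt] := (merging_left As mg', merging_right As mg').
have mlen := merging_len mg'; have mpos := merging_pos mg'.
have T1 : (nmem m2 LEFT 0 < nmem m2 MID 0)%N ->
    ((nmem m2 RIGHT 0 < nmem m2 HI 0)%N -> precedes y (A (nmem m2 LEFT 0)) (A (nmem m2 RIGHT 0))) ->
    nmem (run f (take_from LEFT) m2) CNT 0 = k /\ I k.+1 (run f (take_from LEFT ;; incr CNT) m2).
  move=> im ij; split=> //; split=> //; exists lo'; have := L im ij.
  by rewrite /= /upd /= kE2 AE2 addn1.
have T2 : (nmem m2 RIGHT 0 < nmem m2 HI 0)%N ->
    ((nmem m2 LEFT 0 < nmem m2 MID 0)%N -> precedes y (A (nmem m2 RIGHT 0)) (A (nmem m2 LEFT 0))) ->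
    nmem (run f (take_from RIGHT) m2) CNT 0 = k /\ I k.+1 (run f (take_from RIGHT ;; incr CNT) m2).
  move=> jh ij; split=> //; split=> //; exists lo'; have := Rt jh ij.
  by rewrite /= /upd /= kE2 AE2 addn1.
(* If the left run is used up, the balance of positions gives [RIGHT = k], and [k < HI] shows that
   the right run is not. *)
case: (leqP (nmem m2 MID 0) (nmem m2 LEFT 0)) => im; first by apply: T2; [clear -im kh mlen mpos; lia | rewrite ltnNge im].
case: (leqP (nmem m2 HI 0) (nmem m2 RIGHT 0)) => jh; first by apply: T1; rewrite // ltnNge jh.
case: ifPn => P; first by apply: T1 => // _; rewrite -yE -AE2; exact: P.
by apply: T2 => // _; apply: precedes_total; rewrite -yE -AE2; exact: P.
Qed.

Lemma copy_loop m : has_suffix y m ->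
  runs f (counted size_exp copy_body) m (counted_cost size_exp copy_body * n.+1)
    (fun m' => [/\ has_suffix y m', nmem m' WIDTH 0 = nmem m WIDTH 0 &
       forall i, (i < n)%N -> nmem m' PERM i = nmem m BUF i]).
Proof.
move=> sm; pose I k m' := [/\ has_suffix y m', nmem m' WIDTH 0 = nmem m WIDTH 0,
  nmem m' BUF = nmem m BUF & forall i, (i < k)%N -> nmem m' PERM i = nmem m BUF i].
apply: runs_weaken (_ : runs _ _ _ (_ * _) (I n)) _ _ => //; last by move=> m' [].
apply: runs_counted => //; first by move=> k m' [[[[[]]]]].
move=> k m1 [sm1 wE BE PE] kE kn; split=> //; split=> // i.
rewrite /= /upd /= kE BE ltnS leq_eqVlt; case: eqVneq => [->//|_] /=; exact: PE.
Qed.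

Definition pass_cost : nat := (counted_cost size_exp merge_body +
  counted_cost size_exp copy_body + max_cost merge_init + 20)%N.

Definition sort_inv w0 m : Prop :=
  [/\ has_suffix y m, nmem m WIDTH 0 = w0, (0 < w0)%N, is_order (nmem m PERM) &
      run_sorted (precedes y) (nmem m PERM) w0 n].

Lemma merge_passP w0 m : sort_inv w0 m ->
  runs f merge_pass m (pass_cost * n.+1) (sort_inv w0.*2).
Proof.
case=> sm wE w0p Ao As.
pose Q m' := [/\ sort_inv w0 m', nmem m' LEFT 0 = 0%N, nmem m' MID 0 = 0%N, nmem m' RIGHT 0 = 0%N &
  nmem m' HI 0 = 0%N].
apply: runs_weaken (_ : runs _ _ _ (_ + (_ + (_ + _))) (sort_inv w0.*2)) _ _ => //.
  apply: (runs_seq (Q1 := Q)); first by apply: runs_loop_free.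
  move=> m1 [[sm1 wE1 _ Ao1 As1] l0 mi0 r0 h0].
  apply: runs_seq; first exact: merge_loop sm1 wE1 w0p erefl Ao1 As1 l0 mi0 r0 h0.
  move=> m2 [sm2 wE2 Bo Bs]; apply: runs_seq; first exact: copy_loop sm2.
  move=> m3 [sm3 wE3 PE]; apply: runs_loop_free => //; split=> //=.
  - by rewrite /upd /= wE3 wE2 addnn.
  - by rewrite double_gt0.
  - by rewrite /is_order (eq_slice (B := nmem m2 BUF)) // => k /andP[_]; exact: PE.
  - by move=> k kn kd; rewrite /upd /= !PE; [exact: Bs|lia|lia].
rewrite /pass_cost [X in (_ + (_ + (_ + X)) <= _)%N]/=.
move: (counted_cost _ merge_body) (counted_cost _ copy_body) (max_cost merge_init) => u v z.
nia.
Qed.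

(** Each pass doubles the width, so [k] bounds the passes still to come; the extra unit in [k.+1]
    pays for the final failing test. *)
Lemma merge_passes k w0 m : (n <= w0 * 2 ^ k)%N -> sort_inv w0 m ->
  runs f (While (ltn_exp (nvar WIDTH) size_exp) merge_pass) m ((pass_cost + 10) * n.+1 * k.+1)
    (fun m' => exists2 w1, (n <= w1)%N & sort_inv w1 m').
Proof.
elim: k w0 m => [|k IH] w0 m nw Sm; have [sm wE w0p Ao As] := Sm.
  exists m, (bcost (ltn_exp (nvar WIDTH) size_exp)).+1; split=> /=; first last.
  - by exists w0; rewrite // -[w0]muln1.
  - by lia.
  - have [[[[nE _ _] _] _] _] := sm.
    by apply: ExecWhileF; rewrite /= nE wE negbK -[w0]muln1.
have [[[[nE _ _] _] _] _] := sm.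
have [wn|nw'] := ltnP w0 n; last first.
  exists m, (bcost (ltn_exp (nvar WIDTH) size_exp)).+1; split=> /=; first last.
  - by exists w0.
  - by nia.
  - by apply: ExecWhileF; rewrite /= nE wE negbK.
have [m1 [T1 [E1 TK1 Sm1]]] := merge_passP Sm.
have [|m2 [T2 [E2 TK2 Sm2]]] := IH _ _ _ Sm1; first by rewrite -muln2 -mulnA -expnS.
exists m2, (bcost (ltn_exp (nvar WIDTH) size_exp) + T1 + T2).+1; split=> //.
  by apply: ExecWhileT E1 E2; rewrite /= nE wE -ltnNge.
move: TK1 TK2; rewrite /=; move: pass_cost => u; nia.
Qed.

Definition sort_cost : nat := (counted_cost size_exp id_body + pass_cost + 20)%N.

Lemma merge_sortP m : has_suffix y m ->
  runs f merge_sort m (sort_cost * n.+1 * (trunc_log 2 n).+2)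
    (fun m' => [/\ has_suffix y m', is_order (nmem m' PERM) &
       forall p q, (p < q)%N -> (q < n)%N -> precedes y (nmem m' PERM p) (nmem m' PERM q)]).
Proof.
move=> sm; pose I k m' := has_suffix y m' /\ forall i, (i < k)%N -> nmem m' PERM i = i.
have H1 : runs f (counted size_exp id_body) m (counted_cost size_exp id_body * n.+1) (I n).
  apply: runs_counted => //; first by move=> k m' [[[[[]]]]].
  move=> k m1 [sm1 PE] kE kn; split=> //; split=> // i.
  by rewrite /= /upd /= kE ltnS leq_eqVlt; case: eqVneq => [->//|_] /=; exact: PE.
have H2 m1 : I n m1 -> runs f (nset WIDTH (NCst 1)) m1 3 (sort_inv 1).
  move=> [sm1 PE]; apply: runs_loop_free => //; split=> //=.
    rewrite /is_order (eq_slice (B := id)) => [|k /andP[_]]; last exact: PE.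
    by rewrite /slice map_id /index_iota subn0.
  by move=> k _; rewrite dvd1n.
have H3 m2 : sort_inv 1 m2 -> runs f (While (ltn_exp (nvar WIDTH) size_exp) merge_pass) m2
    ((pass_cost + 10) * n.+1 * (trunc_log 2 n).+2)
    (fun m' => [/\ has_suffix y m', is_order (nmem m' PERM) &
       forall p q, (p < q)%N -> (q < n)%N -> precedes y (nmem m' PERM p) (nmem m' PERM q)]).
  move=> S2; apply: runs_weaken (merge_passes _ S2) (leqnn _) _.
    by rewrite mul1n ltnW // trunc_log_ltn.
  move=> m' [w1 nw [sm' _ w1p Ao As]]; split=> // p q pq qn.
  elim: q pq qn => // q IH; rewrite ltnS leq_eqVlt => pq qn.
  have qq : precedes y (nmem m' PERM q) (nmem m' PERM q.+1).
    (* The final width is at least [n], so no position strictly between 0 and [n] is an exempt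
       boundary. *)
    by apply: As => //; rewrite gtnNdvd //; lia.
  case/orP: pq => [/eqP -> //|pq]; apply: precedes_trans qq.
  by apply: IH => //; exact: ltnW.
apply: runs_weaken (runs_seq H1 (fun m1 h1 => runs_seq (H2 m1 h1) H3)) _ _ => //.
by rewrite /sort_cost; move: (counted_cost _ _) pass_cost (trunc_log 2 n) => u v k; nia.
Qed.

End Sorting.

(** * Greedy values, coefficients and the answer *)

Hypothesis t0 : (0 < t)%N.

Definition increment i : R := aN i - (if block_first s i then 0 else aN i.-1).

Definition greedy_values (A : nat -> nat) (g : nat -> R) k : Prop :=
  forall q, (q < k)%N -> g (A q) =
    f (\sum_(0 <= r < q.+1) increment (A r)) - f (\sum_(0 <= r < q) increment (A r)).

Lemma greedy_loop A m : has_first m -> nmem m PERM = A ->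
  (forall p q, (p < q)%N -> (q < n)%N -> A p != A q) -> rmem m ACC 0 = 0 ->
  runs f (counted size_exp greedy_body) m (counted_cost size_exp greedy_body * n.+1)
    (fun m' => [/\ has_first m', nmem m' PERM = A & greedy_values A (rmem m' GREEDY) n]).
Proof.
move=> fm AE Ainj acc0.
pose I k m := [/\ has_first m, nmem m PERM = A,
  rmem m ACC 0 = \sum_(0 <= r < k) increment (A r) & greedy_values A (rmem m GREEDY) k].
apply: runs_weaken (_ : runs _ _ _ (_ * _) (I n)) _ _ => //; last by move=> m' [].
apply: runs_counted => //.
- by split=> //=; rewrite big_geq.
- by move=> k m' [[[[]]]].
move=> k m1 [fm1 AE1 accE gE] kE kn.
have [[_ [aE _ _ _]] F] := fm1.
set m2 := run f (If (first_test (NGet PERM (nvar CNT))) (rset TMP (RGet 0 (NGet PERM (nvar CNT))))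
    (rset TMP (RSub (RGet 0 (NGet PERM (nvar CNT)))
       (RGet 0 (NSub (NGet PERM (nvar CNT)) (NCst 1)))))) m1.
have [fm2 AE2 accE2 gE2 kE2] : [/\ has_first m2, nmem m2 PERM = A,
    rmem m2 ACC 0 = \sum_(0 <= r < k) increment (A r), rmem m2 GREEDY = rmem m1 GREEDY &
    nmem m2 CNT 0 = k].
  by rewrite /m2 /=; case: ifP => _; split.
have tmpE : rmem m2 TMP 0 = increment (A k).
  rewrite /m2 /= kE AE1 F /increment; case: block_first; rewrite /= /upd /= !aE ?subr0 //.
  by rewrite subn1.
rewrite /greedy_body /= -/m2; split=> //; split=> //.
  by rewrite /= /upd /= accE2 tmpE big_nat_recr.
move=> q; rewrite /= /upd /= kE2 AE2 tmpE accE2 gE2 ltnS leq_eqVlt => /orP[/eqP ->|qk].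
  by rewrite eqxx big_nat_recr.
(* Values are stored under the index [A k], so injectivity of the order protects those written
   earlier. *)
by rewrite ifF ?gE //; apply/negbTE/Ainj.
Qed.

Definition lifted (g eta out : nat -> R) k : Prop := forall i, (i < k)%N ->
  eta i = g i + (if block_first s i then 0 else eta i.-1) /\ out i = eta i + bN i.

Lemma lift_loop A g m : has_first m -> nmem m PERM = A -> rmem m GREEDY = g ->
  rmem m ACC 0 = 0 ->
  runs f (counted size_exp lift_body) m (counted_cost size_exp lift_body * n.+1)
    (fun m' => [/\ has_first m', nmem m' PERM = A, lifted g (rmem m' ETA) (rmem m' OUT) n &
       rmem m' ACC 0 = \sum_(0 <= i < n) rmem m' OUT i * xN i]).
Proof.
move=> fm AE gE acc0.
pose I k m := [/\ has_first m, nmem m PERM = A /\ rmem m GREEDY = g,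
  lifted g (rmem m ETA) (rmem m OUT) k &
  rmem m ACC 0 = \sum_(0 <= i < k) rmem m OUT i * xN i].
apply: runs_weaken (_ : runs _ _ _ (_ * _) (I n)) _ _ => //; last by move=> m' [? [? ?]].
apply: runs_counted => //.
- by split=> //=; rewrite big_geq.
- by move=> k m' [[[[]]]].
move=> k m1 [fm1 [AE1 gE1] lE accE] kE kn.
have [[_ [_ bE xE _]] F] := fm1.
set m2 := run f (If (first_test (nvar CNT)) (RSet ETA (nvar CNT) (RGet GREEDY (nvar CNT)))
    (RSet ETA (nvar CNT) (RAdd (RGet GREEDY (nvar CNT)) (RGet ETA (NSub (nvar CNT) (NCst 1)))))) m1.
have [fm2 AE2 accE2 gE2 kE2] : [/\ has_first m2, nmem m2 PERM = A,
    rmem m2 ACC 0 = \sum_(0 <= i < k) rmem m1 OUT i * xN i, rmem m2 GREEDY = g &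
    nmem m2 CNT 0 = k].
  by rewrite /m2 /=; case: ifP => _; split.
have outE : rmem m2 OUT = rmem m1 OUT by rewrite /m2 /=; case: ifP.
have b2E : rmem m2 1 =1 bN by have [[_ []]] := fm2.
have x2E : rmem m2 2 =1 xN by have [[_ []]] := fm2.
have etaE i : rmem m2 ETA i = if i == k then
    g k + (if block_first s k then 0 else rmem m1 ETA k.-1) else rmem m1 ETA i.
  rewrite /m2 /= kE F gE1 subn1.
  by case: (block_first s k); rewrite /= /upd /= ?addr0.
have first0 : block_first s 0 by apply/existsP; exists (Ordinal t0); rewrite block_end0.
rewrite /lift_body /= -/m2; split=> //; split=> //.
- move=> i; rewrite /= /upd /= kE2 outE b2E ltnS leq_eqVlt => /orP[/eqP ->|ik].
    rewrite !eqxx; split=> //; rewrite !etaE eqxx.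
    (* For [k = 0] the predecessor cell would be the one just written; this is excluded because
       position 0 starts a block. *)
    case: ifP => // kf; rewrite ifF //; case: k kf {kE kn lE accE accE2 kE2 etaE}; last by lia.
    by rewrite first0.
  have [lEi oEi] := lE i ik; rewrite !etaE [i == k]ltn_eqF // [i.-1 == k]ltn_eqF; last by lia.
  by [].
- rewrite /= /upd /= kE2 accE2 outE b2E x2E big_nat_recr //=; congr (_ + _).
  by apply: eq_big_nat => i /andP[_ ik]; rewrite ltn_eqF.
Qed.

Definition separation_cost : nat :=
  (counted_cost blocks_exp mark_body + counted_cost size_exp suffix_body + sort_cost +
   counted_cost size_exp greedy_body + counted_cost size_exp lift_body + max_cost answer + 20)%N.

(** What the run establishes, in terms of arrays indexed by naturals; the permutation and the sums
    over [below] enter only in the correctness proof. *)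
Definition separated m : Prop := exists y A g eta,
  [/\ suffix_sums y 0, is_order A,
      forall p q, (p < q)%N -> (q < n)%N -> precedes y (A p) (A q) &
      greedy_values A g n] /\
  [/\ lifted g eta (rmem m OUT) n, nmem m PERM = A &
      nmem m ANS 0 = ~~ (\sum_(0 <= i < n) rmem m OUT i * xN i <= w)].

Lemma order_inj A : is_order A -> forall p q, (p < q)%N -> (q < n)%N -> A p != A q.
Proof.
move=> Ao p q pq qn; have U : uniq (slice A 0 n) by rewrite (perm_uniq Ao) iota_uniq.
have sz : size (slice A 0 n) = n by rewrite size_map size_iota subn0.
have nthE r : (r < n)%N -> nth 0%N (slice A 0 n) r = A r.
  by move=> rn; rewrite (nth_map 0%N) ?size_iota ?subn0 // nth_iota ?subn0.
have pn := ltn_trans pq qn.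
by rewrite -!nthE // nth_uniq ?sz // ltn_eqF.
Qed.

Lemma runs_separation m : (0 < n)%N -> has_input m ->
  (forall i, nmem m FIRST i = 0%N) -> nmem m POS 0 = 0%N ->
  runs f separation m (separation_cost * n.+1 * (trunc_log 2 n).+2) separated.
Proof.
move=> n0 im F0 P0.
(* The tail of the program is treated backwards, each claim being the continuation of the stage
   before it. *)
have H9 m9 y A g eta : has_first m9 -> suffix_sums y 0 -> is_order A ->
    (forall p q, (p < q)%N -> (q < n)%N -> precedes y (A p) (A q)) -> greedy_values A g n ->
    lifted g eta (rmem m9 OUT) n -> nmem m9 PERM = A ->
    rmem m9 ACC 0 = \sum_(0 <= i < n) rmem m9 OUT i * xN i ->
    runs f answer m9 (max_cost answer) separated.
  move=> [[_ [_ _ _ wE]] _] ys Ao Ale gv lv AE accE; apply: runs_loop_free => //.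
  rewrite /= wE accE; case: ifP => accw; exists y, A, g, eta; split=> //; split=> //=;
    by rewrite /upd /= accw.
have H7 m7 y A g : has_first m7 -> suffix_sums y 0 -> is_order A ->
    (forall p q, (p < q)%N -> (q < n)%N -> precedes y (A p) (A q)) -> greedy_values A g n ->
    nmem m7 PERM = A -> rmem m7 GREEDY = g ->
    runs f (rset ACC (RCst 0) ;; counted size_exp lift_body ;; answer) m7
      (3 + (counted_cost size_exp lift_body * n.+1 + max_cost answer)) separated.
  move=> fm ys Ao Ale gv AE gE.
  apply: (runs_seq (Q1 := fun m' => [/\ has_first m', nmem m' PERM = A, rmem m' GREEDY = g &
    rmem m' ACC 0 = 0])); first by apply: runs_loop_free.
  move=> m8 [fm8 AE8 gE8 acc0].
  apply: runs_seq (lift_loop fm8 AE8 gE8 acc0) _ => m9 [fm9 AE9 lv accE].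
  exact: H9 fm9 ys Ao Ale gv lv AE9 accE.
have H5 m5 y A : has_first m5 -> suffix_sums y 0 -> is_order A ->
    (forall p q, (p < q)%N -> (q < n)%N -> precedes y (A p) (A q)) -> nmem m5 PERM = A ->
    runs f (rset ACC (RCst 0) ;; counted size_exp greedy_body ;;
      rset ACC (RCst 0) ;; counted size_exp lift_body ;; answer) m5
      (3 + (counted_cost size_exp greedy_body * n.+1 +
        (3 + (counted_cost size_exp lift_body * n.+1 + max_cost answer)))) separated.
  move=> fm ys Ao Ale AE.
  apply: (runs_seq (Q1 := fun m' => [/\ has_first m', nmem m' PERM = A & rmem m' ACC 0 = 0])).
    by apply: runs_loop_free.
  move=> m6 [fm6 AE6 acc0].
  apply: runs_seq (greedy_loop fm6 AE6 (order_inj Ao) acc0) _ => m7 [fm7 AE7 gv].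
  exact: H7 fm7 ys Ao Ale gv AE7 erefl.
have H1 m1 : has_first m1 -> runs f (RSet SUF size_exp (RCst 0)) m1 4
    (fun m' => has_first m' /\ rmem m' SUF n = 0).
  move=> [[[nE tE sE] rE] F]; apply: runs_loop_free => //; split=> //=.
  by rewrite /upd /= nE eqxx.
rewrite /separation; apply: runs_weaken.
- apply: runs_seq (mark_first im F0 P0) _ => m1 fm1.
  apply: runs_seq (H1 m1 fm1) _ => m2 [fm2 y0].
  apply: runs_seq (suffix_loop fm2 y0) _ => m3 [fm3 ys].
  apply: runs_seq (merge_sortP n0 (conj fm3 erefl)) _ => m5 [[fm5 _] Ao Ale].
  exact: H5 fm5 ys Ao Ale erefl.
- rewrite /separation_cost.
  move: (counted_cost _ mark_body) (counted_cost _ suffix_body) sort_cost => c1 c2 c3.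
  move: (counted_cost _ greedy_body) (counted_cost _ lift_body) (max_cost answer) => c4 c5 c6.
  by move: (trunc_log 2 n) => k; nia.
- by [].
Qed.

End Stages.

(** * Correctness *)

Lemma nth_entries (R : realType) (n : nat) (v : 'rV[R]_n) (i : 'I_n) : nth 0 (entries v) i = v 0 i.
Proof. by rewrite (nth_map i) ?size_enum_ord // nth_ord_enum. Qed.

Lemma separated_correct (R : realType) (n t : nat) (s : 'I_t -> nat) (f : R -> R)
    (a b : 'rV[R]_n) (w : R) (x : 'rV[R]_n) (m : memory R) :
  (0 < t)%N -> is_block_partition n s -> concave f -> f 0 = 0 ->
  (forall i, 0 <= a 0 i) -> block_ascending s a -> (forall i, 0 <= x 0 i) ->
  (forall k : 'I_t, \sum_(i in block n s k) x 0 i <= 1) ->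
  separated f n s (nth 0 (entries a)) (nth 0 (entries b)) (nth 0 (entries x)) w m ->
  correct_output s f a b w x m.
Proof.
move=> t0 part fconc f0 a0 asc x0 xb [y [A [g [eta]]]].
move=> [[[yn yE] Ao Ale gE] [lE mA ansE]].
have Alt i : (i < n)%N -> (A i < n)%N.
  move=> i_n; suff : A i \in iota 0 n by rewrite mem_iota.
  by rewrite -(perm_mem Ao); apply: map_f; rewrite mem_index_iota.
have Ainj : injective (fun i : 'I_n => Ordinal (Alt i (ltn_ord i))).
  move=> i j [Aij]; apply/val_inj/eqP; case: ltngtP => // ij.
    by have := order_inj Ao ij (ltn_ord j); rewrite Aij eqxx.
  by have := order_inj Ao ij (ltn_ord i); rewrite Aij eqxx.
pose delta : 'S_n := perm Ainj.
have deltaE (j : 'I_n) : delta j = A j :> nat by rewrite permE.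
have ySum (l : 'I_n) : y l = \sum_(i | below s l i) x 0 i.
  apply: (sum_above_pred part) => // i; have := yE i; rewrite nth_entries; apply; exact: ltn_ord.
have first0 : block_first s 0 by apply/existsP; exists (Ordinal t0); rewrite block_end0.
pose d := increment s (nth 0 (entries a)).
(* At a block start the increment is an entry of [a], elsewhere a difference of consecutive entries
   of one block. *)
have d0 (i : 'I_n) : 0 <= d i.
  rewrite /d /increment nth_entries; case: ifPn => F; first by rewrite subr0.
  have i0 : (0 < i)%N by case: (i : nat) F => //; rewrite first0.
  have iE : i = i.-1.+1 :> nat by rewrite prednK.
  have i1n : (i.-1 < n)%N by rewrite -iE ltnW.
  have := below_succ part (i := Ordinal i1n) (Ordinal i1n) iE.
  rewrite F below_refl // orbT => /andP[li /existsP[k /andP[lk ik]]].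
  by rewrite (nth_entries a (Ordinal i1n)) subr_ge0; exact: asc lk ik li.
have aSum (i : 'I_n) : a 0 i = \sum_(l | below s l i) d l.
  rewrite -nth_entries; apply: (sum_below_succ part) => // l.
  by rewrite /d /increment subrK.
have etaSum (i : 'I_n) : eta i = \sum_(l | below s l i) g l.
  by apply: (sum_below_succ part) => // l; have [] := lE l (ltn_ord l).
have y_below (l i : 'I_n) : below s l i -> y i <= y l.
  move=> li; rewrite !ySum [leLHS]big_mkcond [leRHS]big_mkcond /=; apply: ler_sum => k _.
  case: ifP => [ik|_]; first by rewrite (below_trans part li ik).
  by case: ifP.
(* Since [x] is nonnegative, [y] decreases weakly along a block. An upper element sorted before a
   lower one would thus be tied with it, and the tie-break by index rules this out. *)
have delta_below (i j : 'I_n) : (i < j)%N -> ~~ below s (delta j) (delta i).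
  move=> ij; apply/negP => ji; have := Ale i j ij (ltn_ord j); rewrite -!deltaE /precedes.
  rewrite (y_below _ _ ji) negb_and /= negbK => /andP[_ ij'].
  have := order_inj Ao ij (ltn_ord j); rewrite -!deltaE => /negP; apply.
  by rewrite eqn_leq ij' (below_leq ji).
have sumA (h : nat -> R) k : (k <= n)%N ->
    \sum_(l in initial delta k) h l = \sum_(0 <= r < k) h (A r).
  elim: k => [|k IH] kn; first by rewrite initial0 big_set0 big_geq.
  pose j := Ordinal kn; rewrite (initialS delta j) big_setU1 ?initial_notin //= deltaE.
  by rewrite IH 1?ltnW // big_nat_recr //= addrC.
have gSum (j : 'I_n) : g (delta j) =
    f (\sum_(l in initial delta j.+1) d l) - f (\sum_(l in initial delta j) d l).
  by rewrite !sumA // 1?ltnW // deltaE; exact: gE.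
have coefE := lift_coef_greedy part f0 fconc delta_below d0 aSum gSum etaSum.
have outE (i : 'I_n) : rmem m OUT i = eta i + b 0 i.
  by have [_] := lE i (ltn_ord i); rewrite nth_entries.
have rhsE : \sum_(0 <= i < n) rmem m OUT i * nth 0 (entries x) i = lepi_rhs s f a b delta x.
  rewrite lepi_rhsE big_mkord -big_split /=; apply: eq_bigr => i _.
  by rewrite outE nth_entries coefE mulrDl.
rewrite rhsE in ansE; case: leP ansE => [xw|wx] /= ansE; [right|left].
  have hull : conv_hull (X_set s f a b) (w, x).
    apply: (conv_hull_greedy part f0 delta_below aSum gSum etaSum ySum).
    (* A suffix sum is at most the sum over its whole block, hence at most 1. *)
    - move=> l; rewrite ySum sumr_ge0 //=; have [k lk] := block_ex part l.
      apply: le_trans (xb k); rewrite [leLHS]big_mkcond [leRHS]big_mkcond /=.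
      apply: ler_sum => i _; case: ifP => [|_]; last by case: ifP.
      by case/andP => _ /existsP[k' /andP[lk' ik']]; rewrite (block_uniq lk lk') ik'.
    - move=> i j; rewrite leq_eqVlt => /orP[/eqP/val_inj -> //|ij].
      by have /andP[] := Ale i j ij (ltn_ord j); rewrite -!deltaE.
    - move: xw; rewrite lepi_rhsE -big_split /=; congr (_ <= _); apply: eq_bigr => i _.
      by rewrite coefE mulrDl.
  split=> //; split=> // delta'; exact: (lepi_valid f0 delta' hull).
split=> //; exists delta; split=> //.
- by move=> j; rewrite mA deltaE.
- by move=> i; rewrite outE coefE.
- by move=> p; exact: lepi_valid.
Qed.

Theorem corollary6p5 (R : realType) :
  exists (separate : cmd) (C : nat),
  forall (n t : nat) (s : 'I_t -> nat) (f : R -> R) (a b : 'rV[R]_n)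
         (w : R) (x : 'rV[R]_n),
    (0 < n)%N -> (0 < t)%N ->
    is_block_partition n s ->
    concave f -> f 0 = 0 ->
    (forall i, 0 <= a 0 i) ->
    block_ascending s a ->
    (forall i, 0 <= x 0 i <= 1) ->
    (forall k : 'I_t, \sum_(i in block n s k) x 0 i <= 1) ->
    exists (m : memory R) (T : nat),
      [/\ exec f separate (input_memory s a b w x) m T,
          (1 < n)%N -> (T <= C * (n * trunc_log 2 n))%N &
          correct_output s f a b w x m].
Proof.
(* The factor 6 comes from [n.+1 <= 2 * n] and [L.+2 <= 3 * L] for [L = trunc_log 2 n], which is
   positive once [1 < n]. *)
exists separation, (6 * separation_cost)%N => n t s f a b w x n0 t0 part fconc f0 a0 asc x01 xb.
have x0 i : 0 <= x 0 i by case/andP: (x01 i).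
have sE (k : 'I_t) : nth 0%N [seq s k | k : 'I_t] k = s k.
  by rewrite (nth_map k) ?size_enum_ord // nth_ord_enum.
have [|i||m [T [run_m TK sep]]] := @runs_separation R f n t s _ (nth 0 (entries a))
  (nth 0 (entries b)) (nth 0 (entries x)) w sE part t0 (input_memory s a b w x) n0.
- by [].
(* Arrays that are not loaded read as 0, so the block-start flags are initially cleared. *)
- by rewrite /= /load /= nth_nil.
- by [].
exists m, T; split=> //; last exact: separated_correct part fconc f0 a0 asc x0 xb sep.
move=> n1; apply: leq_trans TK _.
have L0 : (0 < trunc_log 2 n)%N by rewrite trunc_log_gt0.
by move: separation_cost (trunc_log 2 n) L0 => c L L0; nia.
Qed.
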